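(* Let $X$ and $Y$ be nonempty finite sets. For any two formigrams $\theta_X$ over $X$ and $\theta_Y$ over $Y$, $$d_{\mathrm B}(\mathrm{barc}_{\mathbf{ZZ}}(\theta_X),\mathrm{barc}_{\mathbf{ZZ}}(\theta_Y))\le 2\, d_{\mathrm I}^{\mathrm F}(\theta_X,\theta_Y).$$
   Context: Subpartitions. A subpartition of $X$ is a partition $P$ of a (possibly empty) subset of $X$; its elements are blocks, $\bigcup P$ is its underlying set. $\mathrm{SubPart}(X)$ is the lattice of all subpartitions of $X$, ordered by $P\le Q$ iff every block of $P$ is contained in some block of $Q$; $P\vee Q$ is the finest common coarsening. Formigrams. A formigram over $X$ is a map $\theta_X:\mathbb{R}\to\mathrm{SubPart}(X)$ such that (a) there is a locally finite set $C\subset\mathbb{R}$ such that $\theta_X$ is constant on each connected component of $\mathbb{R}\setminus C$ and for every $c\in C$ there is $r_c>0$ with $\theta_X(c-\varepsilon)\le\theta_X(c)\ge\theta_X(c+\varepsilon)$ for all $\varepsilon\in[0,r_c)$; (b) for each $x\in X$ there is a (nonempty) closed interval $I_x\subset\mathbb{R}$ with $x\in\bigcup\theta_X(t)$ iff $t\in I_x$. Let $\mathbf{Int}$ be the poset of nonempty bounded closed real intervals ordered by inclusion, and $I^\varepsilon=[b-\varepsilon,d+\varepsilon]$ for $I=[b,d]$, $\varepsilon\ge0$. Write $\bigvee_I\theta_X=\bigvee\{\theta_X(t):t\in I\}$. Distance. A tripod $R$ between $X$ and $Y$ is a set $Z$ with surjections $\varphi_X:Z\to X$, $\varphi_Y:Z\to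 Y$. For a surjection $\varphi:Z\to X$, $(\varphi^*\theta_X)(t)=\{\varphi^{-1}(B):B\in\theta_X(t)\}$. For formigrams $\theta,\theta'$ over the same set $Z$, $d_{\mathrm I}^{\mathrm{SubPart}(Z)}(\theta,\theta')=\inf\{\varepsilon\ge0:\ \forall I\in\mathbf{Int},\ \bigvee_I\theta\le\bigvee_{I^\varepsilon}\theta'\text{ and }\bigvee_I\theta'\le\bigvee_{I^\varepsilon}\theta\}$. $R$ is an $\varepsilon$-tripod between $\theta_X$ and $\theta_Y$ if $d_{\mathrm I}^{\mathrm{SubPart}(Z)}(\varphi_X^*\theta_X,\varphi_Y^*\theta_Y)\le\varepsilon$. $d_{\mathrm I}^{\mathrm F}(\theta_X,\theta_Y)$ is the minimum (infimum) of those $\varepsilon\ge0$ for which an $\varepsilon$-tripod exists ($+\infty$ if none). Zigzag barcode. Fix a field $\mathbb{F}$. Let $F_{\theta_X}:\mathbf{Int}\to\mathbf{vec}$ (finite-dimensional $\mathbb{F}$-vector spaces) send $I$ to the vector space with basis the set of blocks $\bigvee_I\theta_X$, and $I\subset J$ to the linear extension of the map sending a block to the unique block of $\bigvee_J\theta_X$ containing it. An interval of a poset is a nonempty, convex subset that is connected (any two elements are joined by a finite sequence of consecutively comparable elements of it); the interval module of $\mathcal{J}$ is $\mathbb{F}$ on $\mathcal{J}$ with identity maps and $0$ elsewhere. It is known that $F_{\theta_X}$ is isomorphic to a direct sum of interval modules over a unique multiset $\mathrm{barc}(F_{\theta_X})$ of intervals of $\mathbf{Int}$. $\mathrm{barc}_{\mathbf{ZZ}}(\theta_X)$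 is the multiset of the (nonempty) real intervals $\{t\in\mathbb{R}:[t,t]\in\mathcal{J}\}$, $\mathcal{J}\in\mathrm{barc}(F_{\theta_X})$. Bottleneck distance. $\langle b,d\rangle$ denotes a real interval of any type with endpoints $b\le d$ in $[-\infty,\infty]$. For a multiset $\mathcal{A}$ of real intervals and $\varepsilon\geq0$, $\mathcal{A}^\varepsilon$ is the sub-multiset of intervals containing $[t,t+\varepsilon]$ for some $t$. A $\delta$-matching between $\mathcal{A}$ and $\mathcal{B}$ is an injective partial function $\sigma$ from $\mathcal{A}$ to $\mathcal{B}$ whose domain contains $\mathcal{A}^{2\delta}$, whose image contains $\mathcal{B}^{2\delta}$, and such that $\sigma\langle b,d\rangle=\langle b',d'\rangle$ implies $\langle b,d\rangle\subset\langle b'-\delta,d'+\delta\rangle$ and $\langle b',d'\rangle\subset\langle b-\delta,d+\delta\rangle$ (types of the thickened intervals kept). $d_{\mathrm B}(\mathcal{A},\mathcal{B})$ is the infimum of $\delta\ge0$ admitting a $\delta$-matching ($+\infty$ if none). *)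

(* Defs.v *)
From HB Require Import structures.
From mathcomp Require Import all_boot all_order all_algebra.
From mathcomp Require Import all_classical all_reals all_analysis.

Set Implicit Arguments.
Unset Strict Implicit.
Unset Printing Implicit Defensive.

Import Order.TTheory GRing.Theory Num.Theory.
Import numFieldNormedType.Exports.

Local Open Scope classical_set_scope.
Local Open Scope ring_scope.

(* The ground set is an arbitrary type, because the apex of a tripod is an
   arbitrary set, even between finite sets. *)
Record subpart (X : Type) := SubPart {
  blocks : set (set X);
  blocksP : exists A : set X, partition blocks id A }.

Definition underlying (X : Type) (P : subpart X) : set X := cover (blocks P) id.

Definition subpart_le (X : Type) (P Q : subpart X) : Prop :=
  forall B, blocks P B -> exists2 C, blocks Q C & B `<=` C.

Section SubpartOrder.
Variable X : Type.
Implicit Types (P Q : subpart X) (B C : set X).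

Lemma subpart_neq0 P B : blocks P B -> B !=set0.
Proof. by have [A [_ _ h]] := blocksP P; exact: h. Qed.

Lemma subpart_eq P B C x : blocks P B -> blocks P C -> B x -> C x -> B = C.
Proof. by have [A [_ h _]] := blocksP P => PB PC Bx Cx; apply: h => //; exists x. Qed.

Lemma subpart_inj P Q : blocks P = blocks Q -> P = Q.
Proof.
case: P Q => [D hD] [E hE] /= DE; case: _ / DE in hE *.
by congr SubPart; exact: Prop_irrelevance.
Qed.

Lemma subpart_le_refl P : subpart_le P P.
Proof. by move=> B PB; exists B. Qed.

Lemma subpart_le_trans P Q S :
  subpart_le P Q -> subpart_le Q S -> subpart_le P S.
Proof.
move=> PQ QS B /PQ[C /QS[D SD CD] BC]; exists D => //; exact: subset_trans CD.
Qed.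

Lemma subpart_le_anti P Q : subpart_le P Q -> subpart_le Q P -> P = Q.
Proof.
move=> PQ QP; apply: subpart_inj.
have sub P1 P2 : subpart_le P1 P2 -> subpart_le P2 P1 -> blocks P1 `<=` blocks P2.
  move=> h12 h21 B P1B; have [C P2C BC] := h12 _ P1B; have [D P1D CD] := h21 _ P2C.
  have [x Bx] := subpart_neq0 P1B.
  have BD : B = D by apply: (subpart_eq P1B P1D Bx); exact/CD/BC.
  by rewrite (_ : B = C)//; apply/seteqP; split=> // y /CD; rewrite BD.
by apply/seteqP; split; exact: sub.
Qed.

End SubpartOrder.

HB.instance Definition _ (X : Type) := gen_eqMixin (subpart X).
HB.instance Definition _ (X : Type) := gen_choiceMixin (subpart X).

Fact subpart_display : Order.disp_t. Proof. exact: Order.Disp tt tt. Qed.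

Section SubpartPOrder.
Variable X : Type.
Implicit Types P Q : subpart X.

Definition subpart_leb P Q : bool := `[< subpart_le P Q >].

Fact subpart_leb_refl : reflexive subpart_leb.
Proof. by move=> P; apply/asboolP; exact: subpart_le_refl. Qed.

Fact subpart_leb_anti : antisymmetric subpart_leb.
Proof. by move=> P Q /andP[/asboolP PQ /asboolP QP]; exact: subpart_le_anti. Qed.

Fact subpart_leb_trans : transitive subpart_leb.
Proof.
move=> P Q S /asboolP PQ /asboolP QS; apply/asboolP.
exact: subpart_le_trans PQ QS.
Qed.

HB.instance Definition _ := Order.Le_isPOrder.Build subpart_display
  (subpart X) subpart_leb_refl subpart_leb_anti subpart_leb_trans.

Lemma subpart_leP P Q : reflect (subpart_le P Q) (P <= Q)%O.
Proof. exact: asboolP. Qed.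

End SubpartPOrder.

Section SubpartJoin.
Variable X : Type.
Implicit Types (P Q : subpart X) (S : set (subpart X)).

Fact subpart0_subproof : exists A : set X, partition (@set0 (set X)) id A.
Proof. by exists (cover set0 id); split => //; exact: trivIset_set0. Qed.

Definition subpart0 : subpart X := SubPart subpart0_subproof.

(* The join of a family, i.e. its finest common coarsening; the default value
   [subpart0] of [supremum] is the correct value for the empty family, and is
   not used otherwise, by [subpart_supremumsP]. *)
Definition subpart_join S : subpart X := supremum subpart0 S.

Let U S : set X := \bigcup_(P in S) underlying P.
Let E S (x y : X) : Prop :=
  forall Q, ubound S Q -> exists C, [/\ blocks Q C, C x & C y].
Let D S : set (set X) := [set B | exists2 x, U S x & B = [set y | U S y /\ E S x y]].

Let in_ubound S Q x : ubound S Q -> U S x -> exists2 C, blocks Q C & C x.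
Proof.
move=> SQ [P SP [B PB Bx]].
by have /subpart_leP/(_ _ PB)[C QC BC] := SQ _ SP; exists C => //; exact: BC.
Qed.

Let E_refl S x : U S x -> E S x x.
Proof. by move=> Ux Q SQ; have [C] := in_ubound SQ Ux; exists C. Qed.

Let E_sym S x y : E S x y -> E S y x.
Proof. by move=> h Q /h[C [? ? ?]]; exists C. Qed.

Let E_trans S x y z : E S x y -> E S y z -> E S x z.
Proof.
move=> h1 h2 Q SQ; have [C [QC Cx Cy]] := h1 _ SQ; have [C' [QC' C'y C'z]] := h2 _ SQ.
by exists C; split => //; rewrite (subpart_eq QC QC' Cy C'y).
Qed.

Fact subpart_join_subproof S : exists A : set X, partition (D S) id A.
Proof.
exists (cover (D S) id); split => //.
- move=> B C [x Ux ->] [y Uy ->] [z [[/= _ xz] [_ yz]]].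
  apply/seteqP; split => t [/= Ut ht]; split => //.
    exact: E_trans yz (E_trans (E_sym xz) ht).
  exact: E_trans xz (E_trans (E_sym yz) ht).
- by move=> B [x Ux ->]; exists x; split => //; exact: E_refl.
Qed.

Lemma subpart_supremumsP S : supremums S !=set0.
Proof.
exists (SubPart (subpart_join_subproof S)); split.
- move=> P SP; apply/subpart_leP => B PB.
  have [x Bx] := subpart_neq0 PB.
  have Ut t : B t -> U S t by move=> Bt; exists P => //; exists B.
  exists [set y | U S y /\ E S x y]; first by exists x => //; exact: Ut.
  move=> y By; split; first exact: Ut.
  move=> Q /(_ _ SP)/subpart_leP/(_ _ PB)[C QC BC].
  by exists C; split => //; exact: BC.
- move=> Q SQ; apply/subpart_leP => _ [x Ux ->].
  have [C QC Cx] := in_ubound SQ Ux; exists C => // y [/= _ /(_ _ SQ)[C' [QC' C'x C'y]]].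
  by rewrite (subpart_eq QC QC' Cx C'x).
Qed.

Lemma subpart_joinP S : supremums S (subpart_join S).
Proof.
rewrite /subpart_join /supremum; case: ifPn => [/eqP ->|_].
  by split => // Q _; apply/subpart_leP.
by case: xgetP => [Q _ //|h]; have [Q /h] := subpart_supremumsP S.
Qed.

Lemma subpart_join_le S S' : S `<=` S' -> (subpart_join S <= subpart_join S')%O.
Proof.
move=> SS'; have [_ h] := subpart_joinP S; have [h' _] := subpart_joinP S'.
by apply: h => P /SS'; exact: h'.
Qed.

End SubpartJoin.

(* \bigvee_A theta, for a set A of times *)
Definition join_over (R : realType) (X : Type) (theta : R -> subpart X)
    (A : set R) : subpart X := subpart_join (theta @` A).

Definition locally_finite (T : topologicalType) (C : set T) : Prop :=
  forall x : T, exists2 U, nbhs x U & finite_set (C `&` U).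

Record formigram (R : realType) (X : Type) := Formigram {
  formigram_fun :> R -> subpart X;
  formigram_tame : exists C : set R, [/\ locally_finite C,
    forall s t, ~ C s -> connected_component (~` C) s t ->
      formigram_fun s = formigram_fun t &
    forall c, C c -> exists2 r : R, 0 < r & forall e, 0 <= e < r ->
      (formigram_fun (c - e)%R <= formigram_fun c)%O /\
      (formigram_fun (c + e)%R <= formigram_fun c)%O];
  formigram_lifespan : forall x : X, exists I : set R,
    [/\ is_interval I, closed I, I !=set0 &
      forall t, underlying (formigram_fun t) x <-> I t] }.

Section Pullback.
Variables (Z X : Type) (phi : Z -> X).
Hypothesis phi_surj : set_surj [set: Z] [set: X] phi.

Fact subpart_pullback_subproof (P : subpart X) :
  exists A : set Z, partition [set phi @^-1` B | B in blocks P] id A.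
Proof.
exists (cover [set phi @^-1` B | B in blocks P] id); split => //.
- move=> _ _ [B PB <-] [C PC <-] [z [/= Bz Cz]].
  by rewrite (subpart_eq PB PC Bz Cz).
- move=> _ [B PB <-]; have [x Bx] := subpart_neq0 PB.
  by have [z _ zx] := phi_surj (I : [set: X] x); exists z; rewrite /preimage/= zx.
Qed.

Definition subpart_pullback (P : subpart X) : subpart Z :=
  SubPart (subpart_pullback_subproof P).

Definition pullback (R : realType) (theta : R -> subpart X) : R -> subpart Z :=
  fun t => subpart_pullback (theta t).

End Pullback.

(* Both directions over all intervals I = [b, d], with I^e = [b - e, d + e]. *)
Definition subpart_interleaved (R : realType) (Z : Type)
    (theta theta' : R -> subpart Z) (e : R) : Prop :=
  forall b d : R, b <= d ->
    (join_over theta `[b, d] <= join_over theta' `[b - e, d + e])%O /\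
    (join_over theta' `[b, d] <= join_over theta `[b - e, d + e])%O.

Definition dI_subpart (R : realType) (Z : Type) (theta theta' : R -> subpart Z)
    : \bar R :=
  ereal_inf [set e%:E | e in [set e : R | 0 <= e /\
    subpart_interleaved theta theta' e]].

Record tripod (X Y : Type) := Tripod {
  apex : Type;
  legl : apex -> X;
  legr : apex -> Y;
  legl_surj : set_surj [set: apex] [set: X] legl;
  legr_surj : set_surj [set: apex] [set: Y] legr }.

Definition is_eps_tripod (R : realType) (X Y : Type) (T : tripod X Y)
    (thetaX : formigram R X) (thetaY : formigram R Y) (e : R) : Prop :=
  (dI_subpart (pullback (@legl_surj _ _ T) thetaX)
              (pullback (@legr_surj _ _ T) thetaY) <= e%:E)%E.

Definition dI_formigram (R : realType) (X Y : Type)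
    (thetaX : formigram R X) (thetaY : formigram R Y) : \bar R :=
  ereal_inf [set e%:E | e in [set e : R | 0 <= e /\
    exists T : tripod X Y, is_eps_tripod T thetaX thetaY e]].

(* Direct sum of an arbitrary family of modules: functions of finite support *)
Record dsum (F : fieldType) (K : Type) (V : K -> lmodType F) := DSum {
  dsum_fun :> forall k, V k;
  dsumP : finite_set [set k | dsum_fun k <> 0] }.

HB.instance Definition _ (F : fieldType) (K : Type) (V : K -> lmodType F) :=
  gen_eqMixin (dsum V).
HB.instance Definition _ (F : fieldType) (K : Type) (V : K -> lmodType F) :=
  gen_choiceMixin (dsum V).

Section DSum.
Variables (F : fieldType) (K : Type) (V : K -> lmodType F).
Implicit Types f g h : dsum V.

Lemma dsum_eq f g : (forall k, f k = g k) -> f = g.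
Proof.
case: f g => [f hf] [g hg] /= fg.
have {}fg : f = g by exact: functional_extensionality_dep fg.
by case: _ / fg in hg *; congr DSum; exact: Prop_irrelevance.
Qed.

Fact dsum0_subproof : finite_set [set k : K | (0 : V k) <> 0].
Proof. by apply: (sub_finite_set _ (finite_set0 K)) => k; exact. Qed.
Definition dsum0 : dsum V := DSum dsum0_subproof.

Fact dsumN_subproof f : finite_set [set k : K | - f k <> 0].
Proof.
by apply: sub_finite_set (dsumP f) => k /= h fk; apply: h; rewrite fk oppr0.
Qed.
Definition dsumN f : dsum V := DSum (dsumN_subproof f).

Fact dsumD_subproof f g : finite_set [set k : K | f k + g k <> 0].
Proof.
have fin : finite_set ([set k | f k <> 0] `|` [set k | g k <> 0]).
  by rewrite finite_setU; split; exact: dsumP.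
apply: sub_finite_set fin => k /= h.
have [fk|/eqP fk] := eqVneq (f k) 0; last by left.
by right=> gk; apply: h; rewrite fk gk addr0.
Qed.
Definition dsumD f g : dsum V := DSum (dsumD_subproof f g).

Fact dsumZ_subproof (a : F) f : finite_set [set k : K | a *: f k <> 0].
Proof.
by apply: sub_finite_set (dsumP f) => k /= h fk; apply: h; rewrite fk scaler0.
Qed.
Definition dsumZ a f : dsum V := DSum (dsumZ_subproof a f).

Fact dsumDA : associative dsumD.
Proof. by move=> f g h; apply: dsum_eq => k /=; exact: addrA. Qed.
Fact dsumDC : commutative dsumD.
Proof. by move=> f g; apply: dsum_eq => k /=; exact: addrC. Qed.
Fact dsum0D : left_id dsum0 dsumD.
Proof. by move=> f; apply: dsum_eq => k /=; exact: add0r. Qed.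
Fact dsumND : left_inverse dsum0 dsumN dsumD.
Proof. by move=> f; apply: dsum_eq => k /=; exact: addNr. Qed.

HB.instance Definition _ :=
  GRing.isZmodule.Build (dsum V) dsumDA dsumDC dsum0D dsumND.

Fact dsumZA a b f : dsumZ a (dsumZ b f) = dsumZ (a * b) f.
Proof. by apply: dsum_eq => k /=; exact: scalerA. Qed.
Fact dsum1Z : left_id 1 dsumZ.
Proof. by move=> f; apply: dsum_eq => k /=; exact: scale1r. Qed.
Fact dsumZDr : right_distributive dsumZ +%R.
Proof. by move=> a f g; apply: dsum_eq => k /=; exact: scalerDr. Qed.
Fact dsumZDl f : {morph dsumZ^~ f : a b / a + b}.
Proof. by move=> a b; apply: dsum_eq => k /=; exact: scalerDl. Qed.

HB.instance Definition _ :=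
  GRing.Zmodule_isLmodule.Build F (dsum V) dsumZA dsum1Z dsumZDr dsumZDl.

Lemma dsumDE f g k : (f + g) k = f k + g k. Proof. by []. Qed.
Lemma dsumZE a f k : (a *: f) k = a *: f k. Proof. by []. Qed.

End DSum.

Section DSumMap.
Variables (F : fieldType) (K : Type) (V W : K -> lmodType F).
Variable u : forall k, {linear V k -> W k}.

Fact dsum_map_subproof (f : dsum V) : finite_set [set k : K | u k (f k) <> 0].
Proof.
by apply: sub_finite_set (dsumP f) => k /= h fk; apply: h; rewrite fk linear0.
Qed.
Definition dsum_map (f : dsum V) : dsum W := DSum (dsum_map_subproof f).

Fact dsum_map_linear : linear dsum_map.
Proof. by move=> a f g; apply: dsum_eq => k /=; exact: linearP. Qed.
HB.instance Definition _ :=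
  GRing.isLinear.Build F (dsum V) (dsum W) *:%R dsum_map dsum_map_linear.

End DSumMap.

(* Vector space with basis T *)
Definition freemod (F : fieldType) (T : Type) : lmodType F :=
  dsum (fun _ : T => F^o).

Section FreeMap.
Variables (F : fieldType) (T U : choiceType) (h : T -> U).

(* Linear extension of h: the coefficient of u in the image of f is the sum of
   the coefficients of f over the fibre of h at u. *)
Definition free_map_fun (f : freemod F T) (u : U) : F :=
  \sum_(t \in h @^-1` [set u]) f t.

Fact free_map_subproof (f : freemod F T) :
  finite_set [set u : U | free_map_fun f u <> 0].
Proof.
apply: (sub_finite_set _ (finite_image h (dsumP f))) => u /= hu.
apply: contrapT => nu; apply: hu; rewrite /free_map_fun fsbig1// => t /= htu.
by apply: contrapT => ft; apply: nu; exists t.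
Qed.
Definition free_map (f : freemod F T) : freemod F U :=
  @DSum F U (fun=> F^o) (free_map_fun f) (free_map_subproof f).

Let fsD (f g : freemod F T) a (A : set T) :
  \sum_(t \in A) (a * f t + g t) = a * (\sum_(t \in A) f t) + \sum_(t \in A) g t :> F.
Proof.
pose B := A `&` ([set t | f t <> 0] `|` [set t | g t <> 0]).
have finB : finite_set B.
  by apply: finite_setIr; rewrite finite_setU; split; exact: dsumP.
have widen (k : T -> F) : (forall t, f t = 0 -> g t = 0 -> k t = 0) ->
    \sum_(t \in A) k t = \sum_(t \in B) k t.
  move=> hk; apply/esym/fsbig_widen => [t []//|t [At nBt]] /=.
  by apply: hk; apply: contrapT => ft; apply: nBt; split => //; [left|right].
rewrite !widen//; last by move=> t -> ->; rewrite mulr0 addr0.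
by rewrite mulr_fsumr -?fsbig_split.
Qed.

Fact free_map_linear : linear free_map.
Proof. by move=> a f g; apply: dsum_eq => u; exact: fsD. Qed.
HB.instance Definition _ := GRing.isLinear.Build F (freemod F T) (freemod F U)
  *:%R free_map free_map_linear.

End FreeMap.

Lemma free_mapE (F : fieldType) (T U : choiceType) (h : T -> U) (f : freemod F T)
    (r : seq T) (u : U) :
  uniq r -> (forall t, t \notin r -> f t = 0) ->
  free_map h f u = \sum_(t <- r | h t == u) f t.
Proof.
move=> ur fr; rewrite /= /free_map_fun [RHS]bigfs//; last by move=> t _ /fr.
by apply: eq_fsbigl; apply/seteqP; split=> t /= /eqP.
Qed.

Lemma freemod_supp (F : fieldType) (T : choiceType) (f : freemod F T) :
  exists2 r : seq T, uniq r & forall t, t \notin r -> f t = 0.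
Proof.
exists (finite_support 0 setT f) => [|t]; first exact: finite_support_uniq.
rewrite in_finite_support ?setTI; last exact: dsumP.
by move=> nt; apply: contrapT => ft; move/negP: nt; apply; rewrite inE.
Qed.

Lemma free_map_id (F : fieldType) (T : choiceType) (h : T -> T) (f : freemod F T) :
  (forall t, h t = t) -> free_map h f = f.
Proof.
move=> hid; apply: dsum_eq => t /=; rewrite /free_map_fun.
rewrite (_ : _ @^-1` _ = [set t]) ?fsbig_set1//.
by apply/seteqP; split=> s /=; rewrite hid.
Qed.

Lemma free_map_comp (F : fieldType) (T U V : choiceType) (g : T -> U) (h : U -> V)
    (gh : T -> V) (f : freemod F T) :
  (forall t, h (g t) = gh t) -> free_map h (free_map g f) = free_map gh f.
Proof.
move=> ghE; apply: dsum_eq => v; have [r ur fr] := freemod_supp f.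
have ur' : uniq (undup (map g r)) by exact: undup_uniq.
rewrite (free_mapE _ _ ur') => [|u]; last first.
  rewrite mem_undup => nu; rewrite (free_mapE _ _ ur fr) big_seq_cond big_pred0//.
  move=> t; apply/negP => /andP[tr /eqP gu]; move/negP: nu; apply.
  by rewrite -gu; exact: map_f.
rewrite (free_mapE _ _ ur fr); under eq_bigr do rewrite (free_mapE _ _ ur fr).
rewrite (exchange_big_dep xpredT)//= [RHS]big_mkcond/=.
rewrite big_seq [RHS]big_seq; apply: eq_bigr => t tr.
have gt : g t \in undup (map g r) by rewrite mem_undup map_f.
rewrite big_mkcond (bigD1_seq (g t))//= eqxx andbT ghE big1 ?addr0// => u.
by rewrite eq_sym => /negPf ->; rewrite andbF.
Qed.

(* Persistence modules over P. The values are arbitrary vector spaces, so that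
   all direct sums exist; those of [formigram_pmod] below are finite-dimensional
   when the ground set is finite. *)
Record pmod (F : fieldType) (d : Order.disp_t) (P : porderType d) := PMod {
  pmod_space :> P -> lmodType F;
  pmod_map : forall p q : P, (p <= q)%O ->
    {linear pmod_space p -> pmod_space q};
  pmod_map_id : forall (p : P) (h : (p <= p)%O) (v : pmod_space p),
    pmod_map h v = v;
  pmod_map_comp : forall (p q r : P) (hpq : (p <= q)%O) (hqr : (q <= r)%O)
      (hpr : (p <= r)%O) (v : pmod_space p),
    pmod_map hqr (pmod_map hpq v) = pmod_map hpr v }.

Definition pmod_iso (F : fieldType) (d : Order.disp_t) (P : porderType d)
    (M N : pmod F P) : Prop :=
  exists f : forall p : P, {linear M p -> N p},
    (forall p, bijective (f p)) /\
    forall (p q : P) (h : (p <= q)%O) (v : M p),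
      f q (pmod_map M h v) = pmod_map N h (f p v).

Record pinterval (d : Order.disp_t) (P : porderType d) := PInterval {
  pinterval_set : set P;
  pinterval_neq0 : pinterval_set !=set0;
  pinterval_convex : forall p q r : P, pinterval_set p -> pinterval_set r ->
    (p <= q <= r)%O -> pinterval_set q;
  pinterval_connected : forall p q : P, pinterval_set p -> pinterval_set q ->
    exists s : seq P, [/\ path (fun x y => (x >=< y)%O) p s, last p s = q &
      forall x, x \in s -> pinterval_set x] }.

Section IntervalModule.
Variables (F : fieldType) (d : Order.disp_t) (P : porderType d).
Variable J : pinterval P.

Let b (p : P) : bool := `[< pinterval_set J p >].

(* Row vectors of length 1 on J and of length 0 elsewhere; [pid_mx 1] is the
   identity matrix of size 1, or an empty matrix. *)
Definition interval_space (p : P) : lmodType F := 'rV[F]_(b p).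

Definition interval_map (p q : P) (_ : (p <= q)%O) :
    {linear interval_space p -> interval_space q} :=
  mulmxr (pid_mx 1 : 'M[F]_(b p, b q)).

Fact interval_map_id (p : P) (h : (p <= p)%O) (v : interval_space p) :
  interval_map h v = v.
Proof.
rewrite /interval_map /= (_ : pid_mx 1 = 1%:M) ?mulmx1//.
by apply/matrixP => i j; rewrite !mxE; case: (b p) i j => [] [[|//] ?] [[|//] ?].
Qed.

Fact interval_map_comp (p q r : P) (hpq : (p <= q)%O) (hqr : (q <= r)%O)
    (hpr : (p <= r)%O) (v : interval_space p) :
  interval_map hqr (interval_map hpq v) = interval_map hpr v.
Proof.
rewrite /interval_map /= -mulmxA mul_pid_mx minnn.
case bq: (b q); first by rewrite minnn.
congr (_ *m _); apply/matrixP => i j; exfalso.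
have bp : b p by case: (b p) i => // -[].
have br : b r by case: (b r) j => // -[].
move: bq; rewrite /b asboolT//.
by apply: (pinterval_convex (asboolW bp) (asboolW br)); rewrite hpq.
Qed.

Definition interval_module : pmod F P :=
  PMod interval_map_id interval_map_comp.

End IntervalModule.

Section DirectSum.
Variables (F : fieldType) (d : Order.disp_t) (P : porderType d).
Variables (K : Type) (M : K -> pmod F P).

Definition dsum_space (p : P) : lmodType F := dsum (fun k => M k p).

Definition dsum_pmod_map (p q : P) (h : (p <= q)%O) :
    {linear dsum_space p -> dsum_space q} :=
  dsum_map (fun k => pmod_map (M k) h).

Fact dsum_pmod_map_id (p : P) (h : (p <= p)%O) (v : dsum_space p) :
  dsum_pmod_map h v = v.
Proof. by apply: dsum_eq => k /=; exact: pmod_map_id. Qed.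

Fact dsum_pmod_map_comp (p q r : P) (hpq : (p <= q)%O) (hqr : (q <= r)%O)
    (hpr : (p <= r)%O) (v : dsum_space p) :
  dsum_pmod_map hqr (dsum_pmod_map hpq v) = dsum_pmod_map hpr v.
Proof. by apply: dsum_eq => k /=; exact: pmod_map_comp. Qed.

Definition dsum_pmod : pmod F P := PMod dsum_pmod_map_id dsum_pmod_map_comp.

End DirectSum.

(* Multisets are families indexed by an arbitrary type. *)
Definition is_barcode (F : fieldType) (d : Order.disp_t) (P : porderType d)
    (M : pmod F P) (K : Type) (J : K -> pinterval P) : Prop :=
  pmod_iso M (dsum_pmod (fun k => interval_module F (J k))).

(* The poset Int of nonempty bounded closed intervals [lo, hi]. *)
Record cint (R : realType) := CInt {
  lo : R;
  hi : R;
  lo_le_hi : lo <= hi }.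

HB.instance Definition _ (R : realType) := gen_eqMixin (cint R).
HB.instance Definition _ (R : realType) := gen_choiceMixin (cint R).

Fact cint_display : Order.disp_t. Proof. exact: Order.Disp tt tt. Qed.

Section CIntPOrder.
Variable R : realType.
Implicit Types I J : cint R.

Definition cint_set I : set R := `[lo I, hi I].

Definition cint_le I J : bool := `[< cint_set I `<=` cint_set J >].

Lemma cint_set_inj I J : cint_set I = cint_set J -> I = J.
Proof.
move: I J => [a b ab] [a' b' ab'] e.
have [] : cint_set (CInt ab') a /\ cint_set (CInt ab') b.
  by rewrite -e /cint_set /= !in_itv /= lexx ab lexx.
have [] : cint_set (CInt ab) a' /\ cint_set (CInt ab) b'.
  by rewrite e /cint_set /= !in_itv /= lexx ab' lexx.
rewrite /cint_set /= !in_itv /= => /andP[h1 _] /andP[_ h2] /andP[h3 _] /andP[_ h4].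
have ea : a = a' by apply/le_anti; rewrite h1 h3.
have eb : b = b' by apply/le_anti; rewrite h2 h4.
by subst a' b'; congr CInt; exact: Prop_irrelevance.
Qed.

Fact cint_le_refl : reflexive cint_le.
Proof. by move=> I; apply/asboolP. Qed.

Fact cint_le_anti : antisymmetric cint_le.
Proof.
by move=> I J /andP[/asboolP IJ /asboolP JI]; apply/cint_set_inj/seteqP.
Qed.

Fact cint_le_trans : transitive cint_le.
Proof.
by move=> J I K /asboolP IJ /asboolP JK; apply/asboolP; exact: subset_trans JK.
Qed.

HB.instance Definition _ := Order.Le_isPOrder.Build cint_display
  (cint R) cint_le_refl cint_le_anti cint_le_trans.

Definition cint_pt (t : R) : cint R := CInt (lexx t).

End CIntPOrder.

Section BlockMap.
Variables (X : Type) (P Q : subpart X).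
Hypothesis PQ : (P <= Q)%O.

Fact block_map_subproof (B : blocks P) :
  exists C : blocks Q, set_val B `<=` set_val C.
Proof.
have /subpart_leP/(_ _ (set_valP B))[C QC BC] := PQ.
by exists (SigSub (mem_set QC)).
Qed.

(* the unique block of Q containing B: see [block_map_uniq] *)
Definition block_map (B : blocks P) : blocks Q := sval (cid (block_map_subproof B)).

Lemma block_map_sub (B : blocks P) : set_val B `<=` set_val (block_map B).
Proof. exact: (svalP (cid (block_map_subproof B))). Qed.

Lemma block_map_uniq (B : blocks P) (C : blocks Q) :
  set_val B `<=` set_val C -> block_map B = C.
Proof.
move=> BC; have [x Bx] := subpart_neq0 (set_valP B).
apply: val_inj; apply: (subpart_eq (set_valP (block_map B)) (set_valP C)).
  exact: (block_map_sub Bx).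
exact: BC.
Qed.

End BlockMap.

Section FormigramModule.
Variables (F : fieldType) (R : realType) (X : Type) (theta : R -> subpart X).

Definition formigram_blocks (I : cint R) : subpart X :=
  join_over theta (cint_set I).

Fact formigram_blocks_le (I J : cint R) :
  (I <= J)%O -> (formigram_blocks I <= formigram_blocks J)%O.
Proof. by move=> /asboolP IJ; apply: subpart_join_le; exact: image_subset. Qed.

Definition formigram_space (I : cint R) : lmodType F :=
  freemod F (blocks (formigram_blocks I)).

Definition formigram_map (I J : cint R) (IJ : (I <= J)%O) :
    {linear formigram_space I -> formigram_space J} :=
  free_map (block_map (formigram_blocks_le IJ)).

Fact formigram_map_id (I : cint R) (h : (I <= I)%O) (v : formigram_space I) :
  formigram_map h v = v.
Proof.
apply: (@free_map_id F _ (block_map (formigram_blocks_le h)) v) => B.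
exact: block_map_uniq.
Qed.

Fact formigram_map_comp (I J L : cint R) (hIJ : (I <= J)%O) (hJL : (J <= L)%O)
    (hIL : (I <= L)%O) (v : formigram_space I) :
  formigram_map hJL (formigram_map hIJ v) = formigram_map hIL v.
Proof.
apply: (@free_map_comp F _ _ _ (block_map (formigram_blocks_le hIJ))
  (block_map (formigram_blocks_le hJL)) (block_map (formigram_blocks_le hIL)) v).
move=> B; apply/esym/block_map_uniq.
have := @block_map_sub _ _ _ (formigram_blocks_le hJL) (block_map (formigram_blocks_le hIJ) B).
by apply: subset_trans; exact: block_map_sub.
Qed.

Definition formigram_pmod : pmod F (cint R) :=
  PMod formigram_map_id formigram_map_comp.

End FormigramModule.

Arguments formigram_pmod F {R X} theta.

(* The multiset of the nonempty sets {t | [t, t] \in J k}, k : K *)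
Definition barcZZ (R : realType) (K : Type) (J : K -> pinterval (cint R)) :
    {k : K | exists t, pinterval_set (J k) (cint_pt t)} -> set R :=
  fun k => [set t | pinterval_set (J (sval k)) (cint_pt t)].

Arguments barcZZ {R K} J k.

Definition shift_bound (R : realType) (b : itv_bound R) (e : R) : itv_bound R :=
  match b with
  | BSide side x => BSide side (x + e)
  | BInfty side => BInfty R side
  end.

(* <b - e, d + e> for the real interval A = <b, d>: [Rhull A] recovers the
   endpoints of A together with their types. *)
Definition thicken (R : realType) (e : R) (A : set R) : set R :=
  let: Interval l u := Rhull A in
  [set` Interval (shift_bound l (- e)) (shift_bound u e)].

Definition long (R : realType) (e : R) (A : set R) : Prop :=
  exists t, `[t, t + e] `<=` A.

Definition is_matching (R : realType) (K L : Type) (A : K -> set R)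
    (B : L -> set R) (delta : R) (sigma : K -> option L) : Prop :=
  [/\ forall k k' l, sigma k = Some l -> sigma k' = Some l -> k = k',
      forall k, long (2 * delta) (A k) -> exists l, sigma k = Some l,
      forall l, long (2 * delta) (B l) -> exists k, sigma k = Some l &
      forall k l, sigma k = Some l ->
        A k `<=` thicken delta (B l) /\ B l `<=` thicken delta (A k)].

Definition dB (R : realType) (K L : Type) (A : K -> set R) (B : L -> set R) :
    \bar R :=
  ereal_inf [set delta%:E | delta in [set delta : R | 0 <= delta /\
    exists sigma, is_matching A B delta sigma]].

(* Main.v *)
Require Import Defs.
From Stdlib Require Import Relation_Operators.
From mathcomp Require Import all_boot all_order all_algebra finmap.
From mathcomp Require Import all_classical all_reals all_analysis.
From mathcomp Require Import lra zify.

(* A tripod that interleaves the two formigrams by e induces an e-interleaving of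
   the two modules over Int. Since lifespans are intervals, the module of a
   formigram sends a union of two overlapping intervals to a pushout; this makes
   every bar a block, i.e. a set of intervals [s, t] cut out by one condition on
   the left and one on the right, each closed (or infinite) or open. A
   homomorphism between two block modules is a scalar, and a nonzero one moves the
   suitably signed endpoints by at most e in one direction. Order the bars of one
   type by the sum of their signed endpoints. As the composite of the two
   interleaving homomorphisms is the structure map, the part of the product of the
   two coefficient matrices that lies on one side of this order is the identity,
   even when it is computed with the bars that are e-close to the given ones only.
   This is Hall's condition, for the bars containing an interval of length 4e. The
   Hall matchings in both directions combine to a 2e-matching. *)

Set Implicit Arguments.
Unset Strict Implicit.
Unset Printing Implicit Defensive.

Import Order.TTheory GRing.Theory Num.Theory.
Import numFieldNormedType.Exports.

Local Open Scope classical_set_scope.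
Local Open Scope ring_scope.

(** * Matchings *)

(** Matched bars are [e]-close, so the factor 2 is the price of the length threshold only. The
    product of the coefficient matrices is read off at one interval I together with its thickenings
    by [e] and [2e]. For two bars of one type in the right order, such an I exists if each contains
    some [c - 2e, c + 2e]; hence the length 4e, twice the matching parameter 2e. The order is
    unavoidable for half-open types: if the first bar lies too far to the wrong side of the second,
    no I sees the composite and nothing is known about that entry of the product. The same order
    makes the argument local, since it excludes intermediate bars that are far from both given bars.
    A barcode over a finite set may be infinite (two points that merge and separate forever), so
    Hall's theorem is needed for infinitely many bars. Neighbour sets are finite because all bars
    close to a long bar contain its centre. Exactness is phrased with linear functionals: the
    coordinates of a decomposition are functionals, so each rule for bars comes from testing a
    coordinate. *)

Section Hall.
Variables K L : choiceType.

Definition neighbours (N : K -> {fset L}) (S : {fset K}) : {fset L} :=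
  (\bigcup_(k <- S) N k)%fset.

Lemma neighboursP N S l :
  reflect (exists2 k, k \in S & l \in N k) (l \in neighbours N S).
Proof.
apply: (iffP (bigfcupP _ _ _ _)) => [[k]|[k kS lk]]; last by exists k => //; rewrite kS.
by rewrite andbT => kS lk; exists k.
Qed.

Definition hall_condition (N : K -> {fset L}) (S : {fset K}) : Prop :=
  forall T : {fset K}, (T `<=` S)%fset -> (#|` T| <= #|` neighbours N T|)%N.

Definition is_selector (N : K -> {fset L}) (S : {fset K}) (f : K -> option L) :=
  (forall k, k \in S -> exists2 l, f k = Some l & l \in N k) /\
  {in S &, injective f}.

(** Halmos-Vaughan induction: a nonempty proper subset without surplus of neighbours is matched
    first and the rest is matched into what remains; if every such subset has a surplus, any single
    pair may be matched and removed. *)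
Lemma hall_finite (N : K -> {fset L}) (S : {fset K}) :
  hall_condition N S -> exists f, is_selector N S f.
Proof.
have [n] := ubnP #|` S|; elim: n => // n IHn in N S * => ltSn hall.
have [->|/fset0Pn[k kS]] := eqVneq S fset0; first by exists (fun=> None); split.
have [[T [TS T0 tight]]|loose] := pselect (exists T : {fset K},
    [/\ (T `<` S)%fset, T != fset0 & (#|` neighbours N T| <= #|` T|)%N]).
- have TsubS := fproper_sub TS.
  have [f1 [f1N f1inj]] : exists f, is_selector N T f.
    apply: IHn => [|W WT]; first by have := fproper_ltn_card TS; lia.
    by apply: hall; apply: fsubset_trans WT TsubS.
  have [f2 [f2N f2inj]] : exists f,
      is_selector (fun k => N k `\` neighbours N T)%fset (S `\` T)%fset f.
    apply: IHn => [|W WST].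
      by move: T0; rewrite -cardfs_gt0 cardfsDS //; have := fsubset_leq_card TsubS; lia.
    have dTW : (T `&` W = fset0)%fset.
      apply/fsetP => x; rewrite !inE; apply/negP => /andP[xT /(fsubsetP WST)].
      by rewrite !inE xT.
    have WS : (W `<=` S)%fset.
      by apply/fsubsetP => x /(fsubsetP WST); rewrite !inE => /andP[].
    (* [T] has at most as many neighbours as elements, so the condition for the union of [T] and [W]
       leaves enough neighbours of [W] outside those of [T]. *)
    have /hall : (T `|` W `<=` S)%fset by rewrite fsubUset TsubS.
    rewrite cardfsU dTW cardfs0 subn0.
    have : (neighbours N (T `|` W) `<=` neighbours N T `|`
        neighbours (fun k => N k `\` neighbours N T) W)%fset.
      apply/fsubsetP => l /neighboursP[x]; rewrite !inE => /orP[xT lx|xW lx].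
        by apply/orP; left; apply/neighboursP; exists x.
      have [//|ln /=] := boolP (l \in neighbours N T).
      by apply/neighboursP; exists x => //; rewrite !inE ln.
    by move=> /fsubset_leq_card; rewrite cardfsU; lia.
  exists (fun x => if x \in T then f1 x else f2 x); split.
    move=> x xS; case: ifPn => xT; first exact: f1N.
    have [|l fl] := f2N x; first by rewrite !inE xT.
    by rewrite !inE => /andP[_ lN]; exists l.
  have clash x y : x \in T -> y \in S -> y \notin T -> f1 x <> f2 y.
    move=> xT yS yT; have [l -> lx] := f1N _ xT.
    have [|l' ->] := f2N y; first by rewrite !inE yT.
    rewrite !inE => /andP[l'T _] [ll']; move/negP: l'T; apply; rewrite -ll'.
    by apply/neighboursP; exists x.
  move=> x y xS yS; case: ifPn => xT; case: ifPn => yT.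
  + exact: f1inj.
  + by move=> /clash; case.
  + by move=> /esym /clash; case.
  + by apply: f2inj; rewrite !inE ?xT ?yT.
- have [l lk] : exists l, l \in N k.
    have : (0 < #|` neighbours N [fset k]%fset|)%N.
      by have := hall [fset k]%fset; rewrite cardfs1 fsub1set => /(_ kS).
    rewrite cardfs_gt0 => /fset0Pn[l /neighboursP[k']].
    by rewrite inE => /eqP ->; exists l.
  have [f [fN finj]] : exists f,
      is_selector (fun k => N k `\ l)%fset (S `\ k)%fset f.
    apply: IHn => [|W WS]; first by rewrite (cardfsD1 k) kS in ltSn; lia.
    have [->|W0] := eqVneq W fset0; first by rewrite cardfs0.
    have WltS : (W `<` S)%fset by exact: fsub_proper_trans WS (fproperD1 kS).
    have : (#|` W| < #|` neighbours N W|)%N.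
      by rewrite ltnNge; apply/negP => tight; apply: loose; exists W.
    have : (neighbours N W `<=` l |` neighbours (fun k => N k `\ l) W)%fset.
      apply/fsubsetP => l' /neighboursP[x xW l'x]; rewrite !inE.
      have [//|l'l /=] := eqVneq l' l.
      by apply/neighboursP; exists x => //; rewrite !inE l'l.
    by move=> /fsubset_leq_card; rewrite cardfsU1; lia.
  have fl x : x \in S -> x != k -> f x <> Some l.
    move=> xS xk; have [|l' ->] := fN x; first by rewrite !inE xk.
    by rewrite !inE => /andP[/eqP l'l _] [].
  exists (fun x => if x == k then Some l else f x); split.
    move=> x xS; have [->|xk] := eqVneq x k; first by exists l.
    have [|l' fx] := fN x; first by rewrite !inE xk.
    by rewrite !inE => /andP[_ l'x]; exists l'.
  move=> x y xS yS; have [->|xk] := eqVneq x k; have [->//|yk] := eqVneq y k.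
  + by move=> /esym /fl; case.
  + by move=> /fl; case.
  + by apply: finj; rewrite !inE ?xk ?yk.
Qed.

(* Compactness: follow the selectors of the finite subsets along an ultrafilter
   of large finite subsets. *)
Lemma hall_infinite (A : set K) (N : K -> {fset L}) :
  (forall S : {fset K}, (forall k, k \in S -> A k) ->
    (#|` S| <= #|` neighbours N S|)%N) ->
  exists f : K -> option L,
    [/\ forall k, A k -> exists l, f k = Some l,
        forall k l, f k = Some l -> A k /\ l \in N k &
        forall k k' l, f k = Some l -> f k' = Some l -> k = k'].
Proof.
move=> hall.
have /choice[sel selP] (S : {fset K}) : exists f : K -> option L,
    (forall k, k \in S -> A k) -> is_selector N S f.
  have [SA|nSA] := pselect (forall k, k \in S -> A k); last by exists (fun=> None).
  have [f fP] : exists f, is_selector N S f.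
    by apply: hall_finite => T /fsubsetP TS; apply: hall => k /TS; exact: SA.
  by exists f.
pose finsub := {S : {fset K} | forall k, k \in S -> A k}.
pose up (S : finsub) : set finsub := [set T | (sval S `<=` sval T)%fset].
have UF : ProperFilter (filter_from [set: finsub] up).
  apply: filter_from_proper; last by move=> S _; exists S; rewrite /up /=.
  apply: filter_from_filter.
    have h0 : forall k, k \in (fset0 : {fset K}) -> A k by [].
    by exists (exist _ fset0 h0).
  move=> [S SA] [T TA] _ _.
  have hU : forall k, k \in (S `|` T)%fset -> A k.
    by move=> k; rewrite inE => /orP[/SA|/TA].
  by exists (exist _ _ hU) => // W; rewrite /up /= fsubUset => /andP[].
have [U [UU FU]] := ultraFilterLemma UF.
have Uup S : U (up S) by apply: FU; exists S.
have Umem k : A k -> U [set S : finsub | k \in sval S].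
  move=> Ak; have h1 : forall k', k' \in [fset k]%fset -> A k'.
    by move=> k'; rewrite inE => /eqP ->.
  apply: filterS (Uup (exist _ _ h1)) => S; rewrite /up /= fsub1set.
  by [].
pose W k l : set finsub := [set S | k \in sval S /\ sel (sval S) k = Some l].
have Wlim k : A k -> exists l, U (W k l).
  move=> Ak; apply: contrapT => nW.
  have nWl l : U (~` W k l).
    by have [Wl|//] := in_ultra_setVsetC (W k l) UU; case: nW; exists l.
  (* As [N k] is finite, an ultrafilter that avoids each [W k l] avoids all of them at once, whereas
     the selector of any finite subset containing [k] picks an element of [N k]. *)
  have : U [set S | forall l, l \in (N k : seq L) -> ~ W k l S].
    elim: (N k : seq L) => [|l r IHr]; first by apply: filterS filterT.
    apply: filterS (filterI (nWl l) IHr) => S [h1 h2] l'.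
    by rewrite inE => /predU1P[->|/h2].
  move=> /(filterI (Umem _ Ak)) /filter_ex[[S SA] /= [kS h]].
  have [/(_ _ kS)[l fl lN] _] := selP _ SA.
  exact: (h l).
have /choice[f fP] k : exists o, forall l, o = Some l <-> (A k /\ U (W k l)).
  have [Ak|nAk] := pselect (A k); last by exists None => l; split => // -[].
  have [l Wl] := Wlim _ Ak; exists (Some l) => l'; split => [[<-]//|[_ Wl']].
  have /filter_ex[S [[_ h1] [_ h2]]] : U (W k l `&` W k l') by exact: filterI.
  by rewrite -h1 -h2.
exists f; split.
- by move=> k Ak; have [l Wl] := Wlim _ Ak; exists l; apply/fP.
- move=> k l /fP[Ak Wl]; split => //.
  have /filter_ex[[S SA] [/= kS h]] := Wl.
  by have [/(_ _ kS)[l'] ] := selP _ SA; rewrite h => -[->].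
- move=> k k' l /fP[Ak Wl] /fP[Ak' Wl'].
  have /filter_ex[[S SA] [[/= kS h] [k'S h']]] : U (W k l `&` W k' l).
    exact: filterI.
  by have [_] := selP _ SA; apply => //; rewrite h h'.
Qed.

End Hall.

Definition partial_injective (K L : Type) (f : K -> option L) : Prop :=
  forall k k' l, f k = Some l -> f k' = Some l -> k = k'.

Section MendelsohnDulmage.
Variables (K L : Type) (f : K -> option L) (g : L -> option K).
Hypotheses (finj : partial_injective f) (ginj : partial_injective g).

Inductive reach : K -> Prop :=
| reach_start k : (forall l, g l <> Some k) -> reach k
| reach_step k l k' : reach k -> f k = Some l -> g l = Some k' -> reach k'.

(* On the alternating f-g-paths starting outside the image of g follow f,
   elsewhere follow the inverse of g. *)
Lemma mendelsohn_dulmage : exists h : K -> option L,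
  [/\ partial_injective h,
      forall k, (exists l, f k = Some l) -> exists l, h k = Some l,
      forall l, (exists k, g l = Some k) -> exists k, h k = Some l &
      forall k l, h k = Some l -> f k = Some l \/ g l = Some k].
Proof.
have /choice[h hP] k : exists o, forall l, o = Some l <->
    (reach k /\ f k = Some l) \/ (~ reach k /\ g l = Some k).
  have [rk|nrk] := pselect (reach k).
    by exists (f k) => l; split => [?|[[]|[]]]; first left.
  have [[l gl]|ngl] := pselect (exists l, g l = Some k).
    exists (Some l) => l'; split => [[<-]|[[]|[_ gl']]]//; first by right.
    by rewrite (ginj gl gl').
  by exists None => l; split => // -[[]//|[_ gl]]; case: ngl; exists l.
exists h; split.
- have clash k k' l : reach k -> f k = Some l -> ~ reach k' -> g l = Some k' -> False.
    by move=> rk fk nrk' gl; apply: nrk'; exact: reach_step fk gl.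
  move=> k k' l /hP[[rk fk]|[nrk gl]] /hP[[rk' fk']|[nrk' gl']].
  + exact: finj fk fk'.
  + by case: (clash _ _ _ rk fk nrk' gl').
  + by case: (clash _ _ _ rk' fk' nrk gl).
  + by move: gl'; rewrite gl => -[].
- move=> k [l fk]; have [rk|nrk] := pselect (reach k).
    by exists l; apply/hP; left.
  have [l' gl'] : exists l', g l' = Some k.
    apply: contrapT => ngl; apply: nrk; apply: reach_start => l' gl'.
    by apply: ngl; exists l'.
  by exists l'; apply/hP; right.
- move=> l [k gl]; have [rk|nrk] := pselect (reach k); last first.
    by exists k; apply/hP; right.
  (* Being in the image of [g], [k] is no starting point; it was reached from some [k0], and
     injectivity of [g] shows that the step went through [l]. *)
  case: rk gl => [{}k /(_ l)//|k0 l0 k' rk0 fk0 gl0 gl].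
  by exists k0; apply/hP; left; rewrite (ginj gl gl0).
- by move=> k l /hP[[_]|[_]]; [left|right].
Qed.

End MendelsohnDulmage.

(** * Subpartitions *)

Section SameBlock.
Variable X : Type.
Implicit Types (P Q : subpart X) (S : set (subpart X)).

(** Subpartitions are the same as symmetric transitive relations, with the underlying set as the
    reflexive points. The order becomes inclusion of relations and the join becomes a transitive
    closure. *)
Definition same_block P (x y : X) : Prop := exists B, [/\ blocks P B, B x & B y].

Lemma same_block_sym P x y : same_block P x y -> same_block P y x.
Proof. by move=> [B [PB Bx By]]; exists B. Qed.

Lemma same_block_trans P x y z :
  same_block P x y -> same_block P y z -> same_block P x z.
Proof.
move=> [B [PB Bx By]] [C [PC Cy Cz]]; exists B; split => //.
by rewrite (subpart_eq PB PC By Cy).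
Qed.

Lemma same_block_refl P x y : same_block P x y -> same_block P x x.
Proof. by move=> h; exact: same_block_trans h (same_block_sym h). Qed.

Lemma underlyingE P x : underlying P x <-> same_block P x x.
Proof. by split => [[B PB Bx]|[B [PB Bx _]]]; exists B. Qed.

Lemma subpart_leE P Q :
  subpart_le P Q <-> forall x y, same_block P x y -> same_block Q x y.
Proof.
split => [PQ x y [B [/PQ[C QC BC] Bx By]]|PQ B PB].
  by exists C; split => //; exact: BC.
have [x Bx] := subpart_neq0 PB.
have [|C [QC Cx _]] := PQ x x; first by exists B.
exists C => // y By; have [|C' [QC' C'x C'y]] := PQ x y; first by exists B.
by rewrite (subpart_eq QC QC' Cx C'x).
Qed.

Lemma subpart_of_rel (r : X -> X -> Prop) :
  (forall x y, r x y -> r y x) -> (forall x y z, r x y -> r y z -> r x z) ->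
  exists P, forall x y, same_block P x y <-> r x y.
Proof.
move=> rC rT; pose D : set (set X) := [set B | exists2 x, r x x & B = [set y | r x y]].
have partD : exists A, partition D id A.
  exists (cover D id); split => //.
    move=> _ _ [x _ ->] [y _ ->] [z [/= xz yz]]; apply/seteqP; split => t /=.
      by move=> xt; apply: rT yz (rT _ _ _ (rC _ _ xz) xt).
    by move=> yt; apply: rT xz (rT _ _ _ (rC _ _ yz) yt).
  by move=> _ [x rx ->]; exists x.
exists (SubPart partD) => x y; split => [[_ [[z _ ->] /= zx zy]]|xy].
  exact: rT (rC _ _ zx) zy.
have xx := rT _ _ _ xy (rC _ _ xy).
by exists [set t | r x t]; split => //; exists x.
Qed.

(** The transitive closure of the union is again symmetric, so it comes from a subpartition, which
    is an upper bound of [S] and lies below every other one. *)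
Lemma same_block_join S x y : same_block (subpart_join S) x y <->
  clos_trans X (fun x y => exists2 P, S P & same_block P x y) x y.
Proof.
have [ub lub] := subpart_joinP S; set r := fun _ _ => _; split; last first.
  elim => {x y} [x y [P SP xy]|x y z _ xy _ yz]; last exact: same_block_trans xy yz.
  by move: x y xy; apply/subpart_leE/subpart_leP; exact: ub.
have rC x' y' : clos_trans X r x' y' -> clos_trans X r y' x'.
  elim => {x' y'} [x' y' [P SP xy]|x' y' z' _ xy _ yz].
    by apply: t_step; exists P => //; exact: same_block_sym.
  exact: t_trans yz xy.
have [Q QE] := subpart_of_rel rC (@t_trans X r).
suff /subpart_leP/subpart_leE QJ : (subpart_join S <= Q)%O by move=> /QJ/QE.
apply: lub => P SP; apply/subpart_leP/subpart_leE => x' y' xy.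
by apply/QE/t_step; exists P.
Qed.

Lemma same_block_join_over (R : realType) (theta : R -> subpart X) (A : set R) x y :
  same_block (join_over theta A) x y <->
  clos_trans X (fun x y => exists2 t, A t & same_block (theta t) x y) x y.
Proof.
rewrite same_block_join; split; elim => {x y} [x y|x y z _ xy _ yz];
  try exact: t_trans xy yz.
- by move=> [_ [t At <-] xy]; apply: t_step; exists t.
- by move=> [t At xy]; apply: t_step; exists (theta t) => //; exists t.
Qed.

Lemma underlying_join_over (R : realType) (theta : R -> subpart X) (A : set R) x :
  underlying (join_over theta A) x <-> exists2 t, A t & underlying (theta t) x.
Proof.
rewrite underlyingE same_block_join_over; split => [|[t At /underlyingE xt]].
  suff H y : clos_trans X (fun x y => exists2 t, A t & same_block (theta t) x y) x y ->
    exists2 t, A t & underlying (theta t) x by exact: H.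
  elim => [{}x {}y [t At /same_block_refl xt]|//].
  by exists t => //; exact/underlyingE.
by apply: t_step; exists t.
Qed.

End SameBlock.

Lemma same_block_pullback (Z X : Type) (phi : Z -> X)
    (hphi : set_surj [set: Z] [set: X] phi) (P : subpart X) (z z' : Z) :
  same_block (subpart_pullback hphi P) z z' <-> same_block P (phi z) (phi z').
Proof.
split => [[_ [[B PB <-] /= zB z'B]]|[B [PB zB z'B]]]; first by exists B.
by exists (phi @^-1` B); split => //; exists B.
Qed.

Lemma same_block_join_pullback (R : realType) (Z X : Type) (phi : Z -> X)
    (hphi : set_surj [set: Z] [set: X] phi) (theta : R -> subpart X) (A : set R) z z' :
  same_block (join_over (pullback hphi theta) A) z z' <->
  same_block (join_over theta A) (phi z) (phi z').
Proof.
rewrite !same_block_join_over; split.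
  elim => {z z'} [z z' [t At /same_block_pullback zz']|? ? ? _ h _ h'].
    by apply: t_step; exists t.
  exact: t_trans h h'.
move: {1 3}(phi z) (erefl (phi z)) {1 3}(phi z') (erefl (phi z')) => x xE y yE xy.
elim: xy z xE z' yE => {x y} [x y [t At xy] z xE z' yE|x y w _ h _ h' z xE z' yE].
  by apply: t_step; exists t => //; apply/same_block_pullback; rewrite -xE -yE.
(* Surjectivity lifts the intermediate point of a chain to [Z]. *)
have [u _ uy] := hphi y I.
by apply: t_trans (h _ xE u _) (h' u _ _ yE).
Qed.

(** * Functionals on free modules *)

Lemma scalar0 (F : fieldType) (V : lmodType F) (phi : V -> F) : scalar phi -> phi 0 = 0.
Proof. by move=> lphi; rewrite -[X in phi X](addNr 0) -scaleN1r lphi mulN1r addNr. Qed.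

Section FreeModule.
Variables (F : fieldType) (T : choiceType).

Fact free_elt_subproof (t : T) : finite_set [set u : T | ((u == t)%:R : F) <> 0].
Proof.
apply: (sub_finite_set _ (finite_set1 t)) => u /=.
by case: eqVneq => [->//|_ /(_ erefl)].
Qed.

Definition free_elt (t : T) : freemod F T :=
  @DSum F T (fun=> F^o) (fun u => (u == t)%:R) (free_elt_subproof t).

Lemma freemod_decomp (f : freemod F T) (r : seq T) :
  uniq r -> (forall t, t \notin r -> f t = 0) ->
  f = \sum_(t <- r) (f t : F) *: free_elt t.
Proof.
move=> ur fr; apply: dsum_eq => u.
have -> : (\sum_(t <- r) (f t : F) *: free_elt t) u =
    \sum_(t <- r) (f t : F) * (u == t)%:R :> F.
  by elim/big_rec2: _ => // t y x _ <-; rewrite dsumDE dsumZE.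
have [ur'|nur] := boolP (u \in r).
  rewrite (bigD1_seq u) //= eqxx mulr1 big1 ?addr0// => t.
  by rewrite eq_sym => /negPf ->; rewrite mulr0.
rewrite fr// big_seq big1// => t tr; case: eqVneq => [ut|]; last by rewrite mulr0.
by rewrite -ut (negPf nur) in tr.
Qed.

Lemma scalar_sum (V : lmodType F) (phi : V -> F) (I : Type) (r : seq I)
    (c : I -> F) (v : I -> V) :
  scalar phi -> phi (\sum_(i <- r) c i *: v i) = \sum_(i <- r) c i * phi (v i).
Proof.
move=> lphi; elim: r => [|i r IHr]; last by rewrite !big_cons lphi IHr.
by rewrite !big_nil scalar0.
Qed.

Lemma freemod_scalar0 (phi : freemod F T -> F) :
  scalar phi -> (forall t, phi (free_elt t) = 0) -> forall f, phi f = 0.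
Proof.
move=> lphi phi0 f; have [r ur fr] := freemod_supp f.
by rewrite (freemod_decomp ur fr) scalar_sum// big1// => t _; rewrite phi0 mulr0.
Qed.

Lemma freemod_scalar_ex (h : T -> F) :
  exists2 phi : freemod F T -> F, scalar phi & forall t, phi (free_elt t) = h t.
Proof.
pose phi (f : freemod F T) : F := \sum_(t \in [set: T]) (f t : F) * h t.
have phiE (f : freemod F T) r : uniq r -> (forall t, t \notin r -> f t = 0) ->
    phi f = \sum_(t <- r) (f t : F) * h t.
  move=> ur fr; rewrite /phi (bigfs _ ur)//.
    by apply: eq_fsbigl; apply/seteqP; split.
  by move=> t _ /fr ->; rewrite mul0r.
exists phi => [a f g|t]; last first.
  rewrite (phiE _ [:: t])// ?big_seq1 /= ?eqxx ?mul1r// => u.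
  by rewrite inE => /negPf ->.
have [r _ fr] := freemod_supp f; have [s _ gs] := freemod_supp g.
have urs := undup_uniq (r ++ s).
have frs t : t \notin undup (r ++ s) -> f t = 0.
  by rewrite mem_undup mem_cat negb_or => /andP[/fr].
have grs t : t \notin undup (r ++ s) -> g t = 0.
  by rewrite mem_undup mem_cat negb_or => /andP[_ /gs].
rewrite !(phiE _ _ urs)// ?mulr_sumr -?big_split; last first.
  by move=> t nt; rewrite dsumDE dsumZE frs// grs// scaler0 addr0.
by apply: eq_bigr => t _; rewrite dsumDE dsumZE mulrDl -mulrA.
Qed.

End FreeModule.

Lemma free_map_elt (F : fieldType) (T U : choiceType) (h : T -> U) (t : T) :
  free_map h (free_elt F t) = free_elt F (h t).
Proof.
apply: dsum_eq => u; rewrite (@free_mapE _ _ _ _ _ [:: t])//=.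
  by rewrite big_mkcond big_seq1 eqxx eq_sym; case: ifP.
by move=> t'; rewrite inE => /negPf ->.
Qed.

(** * Modules of formigrams *)

Section CInt.
Variable R : realType.
Implicit Types I J : cint R.

Lemma cint_leE I J : (I <= J)%O = (lo J <= lo I) && (hi I <= hi J).
Proof.
apply/asboolP/andP => [IJ|[JI IJ] x]; rewrite /cint_set /=.
  have := IJ (lo I); have := IJ (hi I).
  rewrite /cint_set /= !in_itv /= !lexx (lo_le_hi I) /=.
  by move=> /(_ erefl)/andP[_ ->] /(_ erefl)/andP[->].
by rewrite !in_itv /= => /andP[Ix xI]; rewrite (le_trans JI)//= (le_trans xI).
Qed.

Fact cint_thicken_subproof (e : R) (he : 0 <= e) I : lo I - e <= hi I + e.
Proof. by have := lo_le_hi I; lra. Qed.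

Definition cint_thicken (e : R) (he : 0 <= e) I : cint R :=
  CInt (cint_thicken_subproof he I).

Lemma cint_thicken_le (e : R) (he : 0 <= e) I J :
  (I <= J)%O -> (cint_thicken he I <= cint_thicken he J)%O.
Proof. by rewrite !cint_leE /= lerD2r lerD2r. Qed.

Lemma cint_le_thicken2 (e : R) (he : 0 <= e) I :
  (I <= cint_thicken he (cint_thicken he I))%O.
Proof. by rewrite cint_leE /=; apply/andP; split; lra. Qed.

End CInt.

Section ModuleProperties.
Variables (F : fieldType) (R : realType).
Implicit Types M N : pmod F (cint R).

(* The next two properties say, dually, that the value at a union of two
   overlapping intervals is the pushout of the values at the two intervals over
   the value at their intersection. *)
Definition cover_surjective M : Prop := forall (A B U : cint R)
  (AU : (A <= U)%O) (BU : (B <= U)%O), lo A = lo U -> hi B = hi U -> lo B <= hi A ->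
  forall phi : M U -> F, scalar phi -> (forall v, phi (pmod_map M AU v) = 0) ->
  (forall v, phi (pmod_map M BU v) = 0) -> forall v, phi v = 0.

Definition cover_exact M : Prop := forall (A B U V : cint R)
  (AU : (A <= U)%O) (BU : (B <= U)%O) (VA : (V <= A)%O) (VB : (V <= B)%O),
  lo A = lo U -> hi B = hi U -> lo V = lo B -> hi V = hi A ->
  forall (alpha : M A -> F) (beta : M B -> F), scalar alpha -> scalar beta ->
  (forall v, alpha (pmod_map M VA v) = beta (pmod_map M VB v)) ->
  exists gamma : M U -> F, [/\ scalar gamma,
    forall v, gamma (pmod_map M AU v) = alpha v &
    forall v, gamma (pmod_map M BU v) = beta v].

(** In dual form: the value at [p, p] surjects onto the values at all short intervals around p. This
    is what remains of tameness, and it forces every bar to contain a point interval. *)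
Definition locally_generated M : Prop := forall p : R, exists2 r : R, 0 < r &
  forall (I : cint R) (pI : (cint_pt p <= I)%O), p - r < lo I -> hi I < p + r ->
  forall phi : M I -> F, scalar phi -> (forall v, phi (pmod_map M pI v) = 0) ->
  forall v, phi v = 0.

Definition pointwise_finite M : Prop := forall I : cint R, exists n : nat,
  exists d : 'I_n -> M I, forall phi : M I -> F, scalar phi ->
  (forall i, phi (d i) = 0) -> forall v, phi v = 0.

Definition interleaving M N (e : R) (he : 0 <= e)
    (f : forall I, {linear M I -> N (cint_thicken he I)})
    (g : forall I, {linear N I -> M (cint_thicken he I)}) : Prop :=
  [/\ forall I J (IJ : (I <= J)%O) v,
        f J (pmod_map M IJ v) = pmod_map N (cint_thicken_le he IJ) (f I v),
      forall I J (IJ : (I <= J)%O) v,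
        g J (pmod_map N IJ v) = pmod_map M (cint_thicken_le he IJ) (g I v),
      forall I v, g _ (f I v) = pmod_map M (cint_le_thicken2 he I) v &
      forall I v, f _ (g I v) = pmod_map N (cint_le_thicken2 he I) v].

End ModuleProperties.

Lemma scalarB (F : fieldType) (V : lmodType F) (phi psi : V -> F) :
  scalar phi -> scalar psi -> scalar (fun v => phi v - psi v).
Proof.
by move=> lphi lpsi a u v /=; rewrite lphi lpsi mulrBr opprD addrACA.
Qed.

Lemma scalar_comp (F : fieldType) (V W : lmodType F) (phi : W -> F)
    (f : {linear V -> W}) : scalar phi -> scalar (fun v => phi (f v)).
Proof. by move=> lphi a u v; rewrite linearP lphi. Qed.

Section BlockOf.
Variables (X : Type) (P : subpart X).

Lemma block_of_ex x : underlying P x -> exists B : blocks P, set_val B x.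
Proof. by move=> [B PB Bx]; exists (SigSub (mem_set PB)). Qed.

Lemma block_uniq (B C : blocks P) x : set_val B x -> set_val C x -> B = C.
Proof. by move=> Bx Cx; apply: val_inj; exact: subpart_eq (set_valP B) (set_valP C) Bx Cx. Qed.

Lemma block_underlying (B : blocks P) x : set_val B x -> underlying P x.
Proof. by move=> Bx; exists (set_val B) => //; exact: set_valP. Qed.

Lemma block_inhabited (B : blocks P) : exists x, set_val B x.
Proof. exact: subpart_neq0 (set_valP B). Qed.

Lemma block_same (B : blocks P) x y : set_val B x -> set_val B y -> same_block P x y.
Proof. by move=> Bx By; exists (set_val B); split => //; exact: set_valP. Qed.

Lemma same_block_mem (B : blocks P) x y : set_val B x -> same_block P x y -> set_val B y.
Proof.
move=> Bx [C [PC Cx Cy]].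
by have -> : set_val B = C by exact: subpart_eq (set_valP B) PC Bx Cx.
Qed.

Variable F : fieldType.

(** With its converse [pointwise_scalar], this turns functionals on the span of the blocks into
    functions on points that are constant on blocks; these can be glued pointwise. *)
Lemma scalar_pointwise (phi : freemod F (blocks P) -> F) :
  exists h : X -> F, forall (B : blocks P) x, set_val B x -> h x = phi (free_elt F B).
Proof.
have /choice[h hP] (x : X) : exists c : F,
    forall B : blocks P, set_val B x -> c = phi (free_elt F B).
  have [/block_of_ex[B Bx]|nx] := pselect (underlying P x).
    by exists (phi (free_elt F B)) => C Cx; rewrite (block_uniq Cx Bx).
  by exists 0 => B /block_underlying.
by exists h => B x; exact: hP.
Qed.

Lemma pointwise_scalar (h : X -> F) :
  (forall x y, same_block P x y -> h x = h y) ->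
  exists2 phi : freemod F (blocks P) -> F, scalar phi &
    forall (B : blocks P) x, set_val B x -> phi (free_elt F B) = h x.
Proof.
move=> hP; have /choice[rep repP] := block_inhabited.
have [phi lphi phiE] := @freemod_scalar_ex F (blocks P) (fun B => h (rep B)).
exists phi => // B x Bx; rewrite phiE; apply: hP.
exact: block_same (repP B) Bx.
Qed.

End BlockOf.

Lemma block_map_eq (X : Type) (P Q : subpart X) (PQ : (P <= Q)%O)
    (B : blocks P) (C : blocks Q) x :
  set_val B x -> set_val C x -> block_map PQ B = C.
Proof. by move=> Bx Cx; apply: (@block_uniq _ _ _ _ x) Cx; exact: block_map_sub. Qed.

Section FormigramProperties.
Variables (R : realType) (F : fieldType) (X : Type).
Implicit Types (I J : cint R).

Section Family.
Variable theta : R -> subpart X.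
Let M := formigram_pmod F theta.

Lemma underlying_blocks I x : underlying (formigram_blocks theta I) x <->
  exists2 t, lo I <= t <= hi I & underlying (theta t) x.
Proof.
rewrite underlying_join_over; split => -[t].
  by rewrite /cint_set /= in_itv /=; exists t.
by exists t => //; rewrite /cint_set /= in_itv.
Qed.

Lemma formigram_map_elt I J (IJ : (I <= J)%O) (B : blocks (formigram_blocks theta I)) :
  pmod_map M IJ (free_elt F B) = free_elt F (block_map (formigram_blocks_le theta IJ) B).
Proof. exact: free_map_elt. Qed.

Lemma formigram_scalar_eq I (phi psi : M I -> F) : scalar phi -> scalar psi ->
  (forall B : blocks (formigram_blocks theta I), phi (free_elt F B) = psi (free_elt F B)) ->
  forall v, phi v = psi v.
Proof.
move=> lphi lpsi h v; apply/eqP; rewrite -subr_eq0; apply/eqP.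
apply: (@freemod_scalar0 F (blocks (formigram_blocks theta I))
  (fun v => phi v - psi v) (scalarB lphi lpsi) _ v).
by move=> B; rewrite h subrr.
Qed.

Lemma map_scalar0 I J (IJ : (I <= J)%O) (phi : M J -> F)
    (C : blocks (formigram_blocks theta J)) x :
  (forall v, phi (pmod_map M IJ v) = 0) -> set_val C x ->
  underlying (formigram_blocks theta I) x -> phi (free_elt F C) = 0.
Proof.
move=> phi0 Cx Ix; have [B Bx] := block_of_ex Ix.
by rewrite -(phi0 (free_elt F B)) formigram_map_elt (block_map_eq _ Bx Cx).
Qed.

(** A block over U has a point alive at some time of U, which belongs to A or to B, so the block is
    the image of a block over A or over B. *)
Lemma formigram_cover_surjective : cover_surjective M.
Proof.
move=> A B U AU BU AUlo BUhi BA phi lphi phiA phiB.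
apply: (@freemod_scalar0 F (blocks (formigram_blocks theta U)) phi lphi) => C.
have [x Cx] := block_inhabited C.
have [t /andP[Ut tU] tx] := (underlying_blocks U x).1 (block_underlying Cx).
have [tA|At] := leP t (hi A).
  by apply: map_scalar0 phiA Cx _; apply/underlying_blocks; exists t; rewrite ?AUlo ?Ut.
apply: map_scalar0 phiB Cx _; apply/underlying_blocks; exists t => //.
by rewrite BUhi tU andbT; lra.
Qed.

End Family.

(** Lifespans being intervals, a point alive both in A and in B is alive in the overlap V. Hence two
    functions that agree over V glue on points, and the result is constant on blocks over U because
    these are generated by the relations at single times. *)
Lemma formigram_cover_exact (theta : formigram R X) :
  cover_exact (formigram_pmod F theta).
Proof.
move=> A B U V AU BU VA VB AUlo BUhi VBlo VAhi alpha beta lalpha lbeta ab.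
have [hA hAP] := scalar_pointwise alpha; have [hB hBP] := scalar_pointwise beta.
have VAB x : underlying (formigram_blocks theta A) x ->
    underlying (formigram_blocks theta B) x -> underlying (formigram_blocks theta V) x.
  move=> /underlying_blocks[t /andP[At tA] tx] /underlying_blocks[u /andP[Bu uB] ux].
  have [L [Litv _ _ LP]] := formigram_lifespan theta x.
  have mid s : t <= s <= u \/ s = t \/ s = u -> underlying (theta s) x.
    move=> [/(Litv _ _ ((LP _).1 tx) ((LP _).1 ux))/LP//|[->|->]//].
  have VV := lo_le_hi V.
  apply/underlying_blocks; have [Bt|tB] := leP (lo B) t.
    by exists t => //; rewrite VBlo VAhi Bt.
  have [uA|Au] := leP u (hi A); first by exists u => //; rewrite VBlo VAhi Bu.
  (* Now [t] precedes and [u] follows the overlap, so the lifespan contains all of it. *)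
  exists (lo B); first by rewrite -VBlo lexx.
  by apply: mid; left; rewrite Bu (ltW tB).
have agree x : underlying (formigram_blocks theta A) x ->
    underlying (formigram_blocks theta B) x -> hA x = hB x.
  move=> Ax Bx; have [C Cx] := block_of_ex (VAB _ Ax Bx).
  have := ab (free_elt F C); rewrite !formigram_map_elt.
  by rewrite -(hAP _ x) -?(hBP _ x)//; exact: block_map_sub.
pose g x := if pselect (underlying (formigram_blocks theta A) x) then hA x else hB x.
have gA x : underlying (formigram_blocks theta A) x -> g x = hA x.
  by rewrite /g; case: pselect.
have gB x : underlying (formigram_blocks theta B) x -> g x = hB x.
  by rewrite /g; case: pselect => // Ax Bx; exact: agree.
have hA_const x y : same_block (formigram_blocks theta A) x y -> g x = g y.
  move=> [C [AC Cx Cy]]; rewrite !gA; try by exists C.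
  by rewrite !(hAP (SigSub (mem_set AC))).
have hB_const x y : same_block (formigram_blocks theta B) x y -> g x = g y.
  move=> [C [AC Cx Cy]]; rewrite !gB; try by exists C.
  by rewrite !(hBP (SigSub (mem_set AC))).
have gU x y : same_block (formigram_blocks theta U) x y -> g x = g y.
  move=> /same_block_join_over; elim => {x y} [x y|x y z _ -> _ ->//].
  move=> [t]; rewrite /cint_set /= in_itv /= => /andP[Ut tU] xy.
  have [tA|At] := leP t (hi A).
    apply/hA_const/same_block_join_over/t_step; exists t => //.
    by rewrite /cint_set /= in_itv /= AUlo Ut.
  apply/hB_const/same_block_join_over/t_step; exists t => //.
  rewrite /cint_set /= in_itv /= BUhi tU andbT -VBlo.
  by have := lo_le_hi V; lra.
have [gamma lgamma gammaP] := pointwise_scalar gU.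
exists gamma; split => // v.
- move: v; apply: formigram_scalar_eq => [||C] //; first exact: scalar_comp.
  rewrite formigram_map_elt; have [x Cx] := block_inhabited C.
  rewrite (gammaP _ x) ?gA ?(hAP _ _ Cx)//; first exact: block_underlying Cx.
  exact: block_map_sub.
- move: v; apply: formigram_scalar_eq => [||C] //; first exact: scalar_comp.
  rewrite formigram_map_elt; have [x Cx] := block_inhabited C.
  rewrite (gammaP _ x) ?gB ?(hBP _ _ Cx)//; first exact: block_underlying Cx.
  exact: block_map_sub.
Qed.

(** Tameness grants this at the critical times; at any other time local finiteness provides a ball
    without critical times, on which the formigram is constant. *)
Lemma formigram_locally_le (theta : formigram R X) (p : R) :
  exists2 r : R, 0 < r & forall t, p - r < t < p + r -> (theta t <= theta p)%O.
Proof.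
have [C [Clf Cconst Cloc]] := formigram_tame theta.
have [Cp|nCp] := pselect (C p).
  have [r r0 rP] := Cloc p Cp; exists r => // t /andP[t1 t2].
  have [pt|tp] := leP p t.
    have [|_] := rP (t - p); first by apply/andP; split; lra.
    by rewrite addrC subrK.
  have [|+ _] := rP (p - t); first by apply/andP; split; lra.
  by rewrite opprB addrC subrK.
have [U Up CU] := Clf p.
have : nbhs p (U `&` ~` (C `&` U)).
  apply: filterI => //; apply: open_nbhs_nbhs; split => [|[]//].
  rewrite openC; apply: compact_closed; first exact: norm_hausdorff.
  exact: finite_compact.
move=> /nbhs_ballP[r /= r0 rU]; exists r => // t pt.
have ballC : ball p r `<=` ~` C by move=> x /rU[Ux nCU] Cx; apply: nCU.
rewrite -(Cconst p t)//; exists (ball p r) => //.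
  split => //; first exact: ballxx.
  by rewrite ball_itv; apply/connected_intervalP; exact: interval_is_interval.
rewrite ball_itv /= in_itv /=; exact: pt.
Qed.

Lemma formigram_locally_generated (theta : formigram R X) :
  locally_generated (formigram_pmod F theta).
Proof.
move=> p; have [r r0 rP] := formigram_locally_le theta p; exists r => // I pI Ilo Ihi.
move=> phi lphi phi0.
apply: (@freemod_scalar0 F (blocks (formigram_blocks theta I)) phi lphi) => C.
have [x Cx] := block_inhabited C.
have [t /andP[It tI] tx] := (underlying_blocks theta I x).1 (block_underlying Cx).
apply: map_scalar0 phi0 Cx _; apply/underlying_blocks.
exists p; first by rewrite /= !lexx.
have /rP/subpart_leP/subpart_leE tp : p - r < t < p + r by apply/andP; split; lra.
by apply/underlyingE/tp/underlyingE.
Qed.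

End FormigramProperties.

Lemma formigram_pointwise_finite (R : realType) (F : fieldType) (X : finType)
  (theta : R -> subpart X) : pointwise_finite (formigram_pmod F theta).
Proof.
move=> I; exists #|X|.
have /choice[d dP] (x : X) : exists v : formigram_pmod F theta I,
    forall B : blocks (formigram_blocks theta I), set_val B x -> v = free_elt F B.
  have [Px|nx] := pselect (underlying (formigram_blocks theta I) x).
    have [B Bx] := block_of_ex Px.
    by exists (free_elt F B) => C Cx; rewrite (block_uniq Bx Cx).
  by exists 0 => B Bx; case: nx; exact: block_underlying Bx.
exists (fun i => d (enum_val i)) => phi lphi phi0.
apply: (@freemod_scalar0 F (blocks (formigram_blocks theta I)) phi lphi) => B.
have [y By] := block_inhabited B.
by have := phi0 (enum_rank y); rewrite enum_rankK (dP _ _ By).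
Qed.

(** * Interleavings induced by tripods *)

Section CrossMap.
Variables (Z X Y : Type) (l : Z -> X) (r : Z -> Y).
Hypotheses (hl : set_surj [set: Z] [set: X] l).

Definition cross_le (P : subpart X) (Q : subpart Y) : Prop :=
  forall z z', same_block P (l z) (l z') -> same_block Q (r z) (r z').

Variables (P : subpart X) (Q : subpart Y).

Lemma cross_map_ex : cross_le P Q -> exists f : blocks P -> blocks Q,
  forall B z, set_val B (l z) -> set_val (f B) (r z).
Proof.
move=> PQ; suff /choice[f fP] : forall B : blocks P, exists C : blocks Q,
    forall z, set_val B (l z) -> set_val C (r z) by exists f.
move=> B; have [x Bx] := block_inhabited B.
have [z _ zx] := hl (I : [set: X] x); rewrite -zx in Bx.
have [C [QC Cz _]] := PQ _ _ (block_same Bx Bx).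
exists (SigSub (mem_set QC)) => z' Bz'.
by apply: same_block_mem (PQ _ _ (block_same Bx Bz')).
Qed.

End CrossMap.

Lemma free_map_comp_eq (F : fieldType) (T U U' V : choiceType) (g : T -> U) (h : U -> V)
    (g' : T -> U') (h' : U' -> V) (f : freemod F T) :
  (forall t, h (g t) = h' (g' t)) ->
  free_map h (free_map g f) = free_map h' (free_map g' f).
Proof.
by move=> E; rewrite (free_map_comp f E) (@free_map_comp _ _ _ _ g' h' (h' \o g')).
Qed.

Section TripodInterleaving.
Variables (R : realType) (F : fieldType) (X Y : Type).
Variables (thetaX : R -> subpart X) (thetaY : R -> subpart Y).

Lemma subpart_interleaved_cross (T : tripod X Y) (e : R) (he : 0 <= e) :
  subpart_interleaved (pullback (@legl_surj _ _ T) thetaX)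
    (pullback (@legr_surj _ _ T) thetaY) e ->
  forall I : cint R,
    cross_le (@legl _ _ T) (@legr _ _ T) (formigram_blocks thetaX I)
      (formigram_blocks thetaY (cint_thicken he I)) /\
    cross_le (@legr _ _ T) (@legl _ _ T) (formigram_blocks thetaY I)
      (formigram_blocks thetaX (cint_thicken he I)).
Proof.
move=> h I; have [/subpart_leP/subpart_leE h1 /subpart_leP/subpart_leE h2] := h _ _ (lo_le_hi I).
split => z z' zz'.
- exact/(same_block_join_pullback (@legr_surj _ _ T))/h1/same_block_join_pullback.
- exact/(same_block_join_pullback (@legl_surj _ _ T))/h2/same_block_join_pullback.
Qed.

(** All maps involved are linear extensions of maps of blocks, and a block is determined by any of
    its points. So each identity follows by tracking one point of the apex. *)
Lemma tripod_interleaving (T : tripod X Y) (e : R) (he : 0 <= e) :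
  subpart_interleaved (pullback (@legl_surj _ _ T) thetaX)
    (pullback (@legr_surj _ _ T) thetaY) e ->
  exists f g, @interleaving F R (formigram_pmod F thetaX) (formigram_pmod F thetaY) e he f g.
Proof.
move=> /subpart_interleaved_cross - /(_ he) cross.
have fex I := cross_map_ex (@legl_surj _ _ T) (cross I).1.
have gex I := cross_map_ex (@legr_surj _ _ T) (cross I).2.
pose f I := sval (cid (fex I)); pose g I := sval (cid (gex I)).
have fP I : forall B z, set_val B (legl z) -> set_val (f I B) (legr z) := svalP (cid (fex I)).
have gP I : forall B z, set_val B (legr z) -> set_val (g I B) (legl z) := svalP (cid (gex I)).
have liftX I (B : blocks (formigram_blocks thetaX I)) :
    exists z : apex T, set_val B (legl z).
  have [x Bx] := block_inhabited B.
  by have [z _ zx] := @legl_surj _ _ T x Logic.I; exists z; rewrite zx.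
have liftY I (B : blocks (formigram_blocks thetaY I)) :
    exists z : apex T, set_val B (legr z).
  have [x Bx] := block_inhabited B.
  by have [z _ zx] := @legr_surj _ _ T x Logic.I; exists z; rewrite zx.
exists (fun I => free_map (f I) : {linear _ -> _}), (fun I => free_map (g I) : {linear _ -> _}).
split => [I J IJ v|I J IJ v|I v|I v].
- apply: free_map_comp_eq => B; have [z Bz] := liftX _ B.
  by apply: (@block_uniq _ _ _ _ (legr z)); [apply/fP/block_map_sub|apply/block_map_sub/fP].
- apply: free_map_comp_eq => B; have [z Bz] := liftY _ B.
  by apply: (@block_uniq _ _ _ _ (legl z)); [apply/gP/block_map_sub|apply/block_map_sub/gP].
- apply: free_map_comp => B; have [z Bz] := liftX _ B.
  by apply: (@block_uniq _ _ _ _ (legl z)); [apply/gP/fP|exact: block_map_sub].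
- apply: free_map_comp => B; have [z Bz] := liftY _ B.
  by apply: (@block_uniq _ _ _ _ (legr z)); [apply/fP/gP|exact: block_map_sub].
Qed.

End TripodInterleaving.

(** * Blocks *)

Section Blocks.
Variable R : realType.
Implicit Types (B : R -> R -> Prop) (a b s t p e : R).

(* B s t says that the interval [s, t] belongs to a given set of intervals. *)
Record block B : Prop := Block {
  block_le : forall s t, B s t -> s <= t;
  block_neq0 : exists s t, B s t;
  block_convex : forall s t s' t' a b, B s t -> B s' t' ->
    s' <= a <= s -> t <= b <= t' -> B a b;
  block_hull : forall s t s' t', B s t -> B s' t' ->
    B (Num.min s s') (Num.max t t');
  block_inter : forall s t s' t', B s t -> B s' t' ->
    s <= s' -> s' <= t -> t <= t' -> B s' t;
  block_cut_right : forall s t s' t', B s t -> ~ B s t' ->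
    s <= s' -> s' <= t -> t <= t' -> B s' t;
  block_cut_left : forall s t s' t', B s' t' -> ~ B s t' ->
    s <= s' -> s' <= t -> t <= t' -> B s' t;
  block_point : forall s t, B s t -> exists2 p, s <= p <= t & B p p }.

(** Reflection of the time axis; statements about right ends are those about left ends of the mirror
    image. *)
Definition mirror B s t : Prop := B (- t) (- s).

Lemma mirrorK B : mirror (mirror B) = B.
Proof. by apply/funext => s; apply/funext => t; rewrite /mirror !opprK. Qed.

Lemma block_mirror B : block B -> block (mirror B).
Proof.
move=> [Ble [s0 [t0 Bst]] Bconvex Bhull Binter Bcutr Bcutl Bpoint]; rewrite /mirror.
split => /=.
- by move=> s t /Ble; rewrite lerN2.
- by exists (- t0), (- s0); rewrite !opprK.
- move=> s t s' t' a b B1 B2 /andP[h1 h2] /andP[h3 h4].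
  by apply: Bconvex B1 B2 _ _; rewrite !lerN2; apply/andP.
- by move=> s t s' t' B1 B2; rewrite oppr_min oppr_max; exact: Bhull.
- by move=> s t s' t' B1 B2 h1 h2 h3; apply: Binter B2 B1 _ _ _; rewrite lerN2.
- move=> s t s' t' B1 B2 h1 h2 h3.
  by apply: (Bcutl (- t') _ _ _ B1 B2); rewrite lerN2.
- move=> s t s' t' B1 B2 h1 h2 h3.
  by apply: (Bcutr _ _ _ (- s) B1 B2); rewrite lerN2.
- move=> s t /Bpoint[p /andP[h1 h2] Bp]; exists (- p); last by rewrite opprK.
  by rewrite lerNr h2 lerNl h1.
Qed.

Definition life B : set R := [set p | B p p].

Definition extends_left B : Prop := forall s t s', B s t -> s' <= s -> B s' t.

(* An endpoint of the block constrains the far end of an interval if it is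
   closed or infinite, and the near end if it is open. *)
Definition left_of B s t : Prop :=
  exists2 a, life B a & a <= if `[< extends_left B >] then t else s.

(** Boundedness belongs to the type so that keys are compared only when both infima are genuine or
    both are the default value. *)
Definition left_type B : bool * bool :=
  (`[< extends_left B >], `[< has_lbound (life B) >]).

(* Signed so that a homomorphism of degree e raises it by at most e; note that
   inf is 0 on a set without lower bound. *)
Definition left_key B : R :=
  if `[< extends_left B >] then inf (life B) else - inf (life B).

(* The position of B and B' that allows a nonzero homomorphism from the interval
   module of B to the e-shift of that of B'. *)
Definition hom_admissible B B' e : Prop :=
  [/\ exists s t, B s t /\ B' (s - e) (t + e),
      forall s t s' t', B s t -> B' (s - e) (t + e) -> s' <= s -> t <= t' ->
        B' (s' - e) (t' + e) -> B s' t' &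
      forall s t s' t', B s t -> B' (s - e) (t + e) -> s <= s' -> t' <= t ->
        B s' t' -> B' (s' - e) (t' + e)].

Lemma hom_admissible_mirror B B' e :
  hom_admissible B B' e -> hom_admissible (mirror B) (mirror B') e.
Proof.
move=> [[s0 [t0 [B0 B'0]]] h1 h2].
have E x : - (x + e) = - x - e by rewrite opprD.
have E' x : - (x - e) = - x + e by rewrite opprB addrC.
rewrite /mirror; split.
- by exists (- t0), (- s0); rewrite E E' !opprK.
- move=> s t s' t'; rewrite !E !E' => Bst B'st s's tt' B'st'.
  by apply: h1 Bst B'st _ _ B'st'; rewrite lerN2.
- move=> s t s' t'; rewrite !E !E' => Bst B'st s's tt' B'st'.
  by apply: h2 Bst B'st _ _ B'st'; rewrite lerN2.
Qed.

Section OneBlock.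
Variable B : R -> R -> Prop.
Hypothesis blockB : block B.

Lemma life_mirror a : life (mirror B) a <-> life B (- a).
Proof. by []. Qed.

Lemma life_neq0 : life B !=set0.
Proof.
by have [s [t /(block_point blockB)[p _ Bp]]] := block_neq0 blockB; exists p.
Qed.

Lemma life_block a b : life B a -> life B b -> a <= b -> B a b.
Proof.
move=> Ba Bb ab; have := block_hull blockB Ba Bb.
by rewrite (min_idPl ab) (max_idPr ab).
Qed.

Lemma life_interval a b p : life B a -> life B b -> a <= p <= b -> life B p.
Proof.
move=> Ba Bb /andP[ap pb]; have Bab := life_block Ba Bb (le_trans ap pb).
have Bap : B a p by apply: (block_convex blockB Ba Bab); rewrite ?lexx ?ap.
have Bpb : B p b by apply: (block_convex blockB Bb Bab); rewrite ?lexx ?pb ?ap.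
exact: (block_inter blockB Bap Bpb).
Qed.

Section NotExtends.
Hypothesis next : ~ extends_left B.

Let cut : exists s1 t1 s0, [/\ B s1 t1, s0 <= s1 & ~ B s0 t1].
Proof.
apply: contrapT => h; apply: next => s t s' Bst s's; apply: contrapT => nB.
by apply: h; exists s, t, s'.
Qed.

(** The obstruction to extending left is given at one right end only; taking the hull with it moves
    it above an arbitrary member, by convexity. *)
Let above s t : B s t -> exists S T s0,
  [/\ B S T, S <= s, t <= T, s0 <= S & ~ B s0 T].
Proof.
move=> Bst; have [s1 [t1 [s0 [B1 s01 nB0]]]] := cut.
exists (Num.min s s1), (Num.max t t1), s0.
have BST := block_hull blockB Bst B1.
have s0S : s0 <= Num.min s s1.
  rewrite leNgt; apply/negP => Ss0; apply: nB0.
  apply: (block_convex blockB B1 BST); first by rewrite (ltW Ss0).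
  by rewrite lexx le_max lexx orbT.
split => //; rewrite ?ge_min ?le_max ?lexx// => B0; apply: nB0.
apply: (block_convex blockB B1 B0); first by rewrite lexx.
by rewrite lexx le_max lexx orbT.
Qed.

(** If [s, T] but not its intersection [s, t'] with [s0, t'] belonged to the block, exactness would
    put the union [s0, T] into the block as well. *)
Lemma open_left_restrict s t t' : B s t -> s <= t' <= t -> B s t'.
Proof.
move=> Bst /andP[st' t't]; have [S [T [s0 [BST Ss tT s0S nB0]]]] := above Bst.
have BsT : B s T by apply: (block_convex blockB Bst BST); rewrite ?Ss ?lexx ?tT.
by apply: (block_cut_left blockB BsT nB0); lra.
Qed.

Lemma open_left_life s t : B s t -> life B s.
Proof.
move=> Bst; apply: (open_left_restrict Bst).
by rewrite lexx (block_le blockB Bst).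
Qed.

Lemma open_left_lbound : exists s0, forall s t, B s t -> s0 <= s.
Proof.
have [s1 [t1 [s0 [B1 s01 nB0]]]] := cut; exists s0 => s t Bst.
rewrite leNgt; apply/negP => ss0; apply: nB0.
have BST := block_hull blockB Bst B1.
apply: (block_convex blockB B1 BST); last by rewrite lexx le_max lexx orbT.
by rewrite s01 andbT ge_min (ltW ss0).
Qed.

End NotExtends.

Lemma block_left_of s t : B s t -> left_of B s t.
Proof.
move=> Bst; rewrite /left_of; case: asboolP => ext.
  by have [p /andP[_ pt] Bp] := block_point blockB Bst; exists p.
by exists s => //; exact: open_left_life Bst.
Qed.

End OneBlock.

(** The conditions at the two ends do not interact, so blocks can be compared one end at a time.
    Asking for a member of the life instead of comparing with an infimum avoids the question whether
    the infimum is attained. *)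
Lemma blockE B s t : block B ->
  B s t <-> [/\ s <= t, left_of B s t & left_of (mirror B) (- t) (- s)].
Proof.
move=> bB; have bB' := block_mirror bB; split=> [Bst|[st]].
  split; [exact: (block_le bB)|exact: block_left_of|].
  by apply: block_left_of; rewrite // /mirror !opprK.
move=> [a Ba aP] [b' /life_mirror Bb bP]; set b := - b' in Bb.
have {}bP : (if `[< extends_left (mirror B) >] then s else t) <= b.
  by rewrite /b; move: bP; case: ifP => _; rewrite lerNr.
move: aP bP; case: asboolP => extl; case: asboolP => extr aP bP.
- have extR u v w : B u v -> v <= w -> B u w.
    move=> Buv vw; have := extr (- v) (- u) (- w).
    by rewrite /mirror !opprK lerN2; exact.
  have [as'|sa] := leP a s.
    by apply: extR st; apply: life_interval Ba Bb _ => //; rewrite as'.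
  by apply: extl (ltW sa); exact: extR aP.
- by apply: extl st; apply: life_interval Ba Bb _ => //; rewrite aP.
- have extR u v w : B u v -> v <= w -> B u w.
    move=> Buv vw; have := extr (- v) (- u) (- w).
    by rewrite /mirror !opprK lerN2; exact.
  by apply: extR st; apply: life_interval Ba Bb _ => //; rewrite aP.
- apply: life_block => //; apply: life_interval Ba Bb _ => //; apply/andP; split; lra.
Qed.

Section Hom.
Variables (B B' : R -> R -> Prop) (e : R).
Hypotheses (blockB : block B) (blockB' : block B') (homB : hom_admissible B B' e).
Hypothesis (e0 : 0 <= e).

Lemma hom_extends_left : extends_left B' -> extends_left B.
Proof.
have [[s [t [Bst B'st]]] h1 _] := homB => ext'; apply: contrapT => next.
have [s0 s0P] := open_left_lbound blockB next.
(* A left end strictly beyond the lower bound [s0] of [B]; [B'] reaches that far, and admissibility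
   pulls this back to [B]. *)
pose s' := Num.min s s0 - 1.
have s's : s' <= s by rewrite /s' lerBlDr ge_min lerDl ler01.
have /s0P : B s' t.
  by apply: (h1 _ _ _ _ Bst B'st) => //; apply: (ext' _ _ _ B'st); rewrite lerB.
by rewrite /s'; have : Num.min s s0 <= s0 by [rewrite ge_min lexx orbT|]; lra.
Qed.

(** A common interval can be enlarged to the left until it contains a. Cutting it off at a stays in
    [B], hence after the shift in [B'], which therefore has a point up to a + e. *)
Lemma hom_life_extends : extends_left B' ->
  forall a, life B a -> exists2 a', life B' a' & a' <= a + e.
Proof.
move=> ext' a Ba; have ext := hom_extends_left ext'.
have [[s [t [Bst B'st]]] h1 h2] := homB.
have [ta|at'] := leP t a.
  have [p /andP[_ pt] B'p] := block_point blockB' B'st.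
  by exists p => //; lra.
pose s' := Num.min s a; have s's : s' <= s by rewrite ge_min lexx.
have s'a : s' <= a by rewrite ge_min lexx orbT.
have B's't : B' (s' - e) (t + e) by apply: ext' B'st _; rewrite lerB.
have Bs't := ext _ _ _ Bst s's.
have Bs'a := ext _ _ _ Ba s'a.
have := h2 _ _ _ _ Bs't B's't (lexx s') (ltW at') Bs'a.
by move=> /(block_point blockB')[p /andP[_ pa] B'p]; exists p.
Qed.

(** Open ends are compared in the opposite direction to closed ones, which is why [left_key] changes
    its sign there. *)
Lemma hom_life_open : ~ extends_left B -> ~ extends_left B' ->
  forall a, life B' a -> exists2 a', life B a' & a' <= a + e.
Proof.
move=> next next' a B'a; have [[s [t [Bst B'st]]] h1 h2] := homB.
have [sa|as'] := leP s (a + e).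
  by exists s => //; exact: open_left_life Bst.
exists (a + e) => //; apply: (@open_left_life _ blockB next _ t).
have st := block_le blockB Bst.
apply: (h1 _ _ _ _ Bst B'st) => //; first exact: ltW.
have h3 : a <= s - e by lra.
have h4 : a <= t + e by move: e0 => ?; lra.
by have := block_hull blockB' B'a B'st; rewrite (min_idPl h3) (max_idPr h4) addrK.
Qed.

Lemma hom_left_of s t : left_type B = left_type B' ->
  left_of B s t -> `[< extends_left B >] -> left_of B' (s - e) (t + e).
Proof.
move=> [ext _] [a Ba aP] extb; rewrite /left_of -ext.
move: aP; rewrite extb => aP; rewrite ext in extb.
by have [a' B'a' aa'] := hom_life_extends (asboolW extb) Ba; exists a' => //; lra.
Qed.

Lemma hom_left_of_open s t : left_type B = left_type B' ->
  left_of B' s t -> ~~ `[< extends_left B >] -> left_of B (s + e) (t - e).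
Proof.
move=> [ext _] [a Ba aP] extb; rewrite /left_of (negPf extb).
move: aP; rewrite -ext (negPf extb) => aP.
move: (extb) (extb) => /asboolPn next1; rewrite ext => /asboolPn next2.
by have [a' B'a' aa'] := hom_life_open next1 next2 Ba; exists a' => //; lra.
Qed.

Lemma inf_shift (A A' : set R) : A !=set0 -> A' !=set0 ->
  `[< has_lbound A >] = `[< has_lbound A' >] ->
  (forall a, A a -> exists2 a', A' a' & a' <= a + e) -> inf A' <= inf A + e.
Proof.
move=> A0 A'0 lb AA'; move: lb; case: asboolP => lbA.
  move=> /esym/asboolP lbA'; rewrite -lerBlDr; apply: lb_le_inf => // a /AA'[a' A'a' aa'].
  by have := ge_inf lbA' A'a'; lra.
(* Without lower bounds both infima are the default value 0, and [e] is nonnegative. *)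
by move=> /esym/asboolPn lbA'; rewrite !inf_out ?add0r// => -[].
Qed.

Lemma hom_left_key : left_type B = left_type B' -> left_key B' <= left_key B + e.
Proof.
move=> [ext lb]; rewrite /left_key -ext; have nB := life_neq0 blockB.
have nB' := life_neq0 blockB'; case: asboolP => extB.
  apply: inf_shift => //; apply: hom_life_extends; apply/asboolP.
  by rewrite -ext; apply/asboolP.
have : inf (life B) <= inf (life B') + e; last by lra.
apply: inf_shift => //; apply: hom_life_open => //; apply/asboolPn.
by rewrite -ext; apply/asboolPn.
Qed.

End Hom.

(* Along homomorphisms the type can change in one direction only, so it is
   constant if it is the same at both ends. *)
Lemma hom_left_type B1 B B2 e : block B1 -> block B -> block B2 ->
  hom_admissible B1 B e -> hom_admissible B B2 e ->
  left_type B1 = left_type B2 -> left_type B = left_type B1.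
Proof.
move=> b1 b b2 h1 h2 [ext lb].
have extE : `[< extends_left B >] = `[< extends_left B1 >].
  apply/idP/idP => /asboolP extB; apply/asboolP.
    exact: hom_extends_left h1 extB.
  by apply: hom_extends_left h2 _ => //; apply/asboolP; rewrite -ext; apply/asboolP.
have transport (A A' : set R) : (forall a, A a -> exists2 a', A' a' & a' <= a + e) ->
    has_lbound A' -> has_lbound A.
  move=> AA' [m mA']; exists (m - e) => a Aa.
  by have [a' A'a' aa'] := AA' _ Aa; have := mA' _ A'a'; lra.
congr pair => //; have [extB|nextB] := pselect (extends_left B).
  have extB2 : extends_left B2.
    by apply/asboolP; rewrite -ext -extE; apply/asboolP.
  apply/idP/idP => /asboolP lbB; apply/asboolP.
    exact: transport (hom_life_extends b1 b h1 extB) lbB.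
  apply: transport (hom_life_extends b b2 h2 extB2) _.
  by apply/asboolP; rewrite -lb; apply/asboolP.
have nextB1 : ~ extends_left B1 by apply/asboolPn; rewrite -extE; apply/asboolPn.
have nextB2 : ~ extends_left B2.
  by apply/asboolPn; rewrite -ext -extE; apply/asboolPn.
have lbd B' : block B' -> ~ extends_left B' -> has_lbound (life B').
  by move=> b' /(open_left_lbound b')[m mP]; exists m => a; exact: mP.
by rewrite !asboolT//; exact: lbd.
Qed.

End Blocks.

Section BlockPairs.
Variable R : realType.
Implicit Types (B : R -> R -> Prop) (s t c d e : R).

(** Homomorphisms carry the condition at a closed end forward and that at an open end backward. So
    it is imposed on the source in the first case, on the shifted target in the second, and then
    holds for every block in between. *)
Definition left_common B1 B2 d s t : Prop :=
  if `[< extends_left B1 >] then left_of B1 s t else left_of B2 (s - d) (t + d).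

Definition common B1 B2 d s t : Prop :=
  [/\ s <= t, left_common B1 B2 d s t &
      left_common (mirror B1) (mirror B2) d (- t) (- s)].

Lemma common_mirror B1 B2 d s t :
  common (mirror B1) (mirror B2) d s t -> common B1 B2 d (- t) (- s).
Proof. by rewrite /common !mirrorK !opprK lerN2 => -[]. Qed.

Definition same_type B B' : Prop :=
  left_type B = left_type B' /\ left_type (mirror B) = left_type (mirror B').

Definition close_blocks B B' e : Prop :=
  [/\ same_type B B', `|left_key B - left_key B'| <= e &
      `|left_key (mirror B) - left_key (mirror B')| <= e].

(** For bounded ends a and b this is a - b if the block extends on both sides, b - a if on neither,
    a + b if only to the left and - a - b if only to the right. *)
Definition key_sum B : R := left_key B + left_key (mirror B).

Definition centered B d c : Prop := life B (c - d) /\ life B (c + d).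

Lemma centered_mirror B d c : centered B d c -> centered (mirror B) d (- c).
Proof.
move=> [h1 h2]; split; apply/life_mirror.
  by rewrite opprB addrC opprK.
by rewrite opprD opprK.
Qed.

Lemma common_self B d s t : block B -> 0 <= d -> common B B d s t ->
  B s t /\ B (s - d) (t + d).
Proof.
move=> bB d0 [st l r].
have self B' s' t' : left_common B' B' d s' t' ->
    left_of B' s' t' /\ left_of B' (s' - d) (t' + d).
  rewrite /left_common /left_of; case: asboolP => ext [a Ba aP].
    by split; exists a => //; lra.
  by split; exists a => //; lra.
have [l1 l2] := self _ _ _ l; have [r1 r2] := self _ _ _ r.
split; apply/(blockE _ _ bB); split => //; first lra.
by rewrite opprD opprB [d - s]addrC.
Qed.

Lemma hom_left_common B1 B B2 e s t : block B1 -> block B -> block B2 -> 0 <= e ->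
  hom_admissible B1 B e -> hom_admissible B B2 e ->
  left_type B1 = left_type B2 -> left_common B1 B2 (e + e) s t ->
  [/\ left_of B1 s t, left_of B (s - e) (t + e) &
      left_of B2 (s - (e + e)) (t + (e + e))].
Proof.
move=> b1 b b2 e0 h1 h2 type12.
have typeB := hom_left_type b1 b b2 h1 h2 type12.
rewrite /left_common; case: asboolP => ext l.
  have extB : extends_left B.
    by apply/asboolP; have [-> _] := typeB; apply/asboolP.
  have lB := hom_left_of b1 b h1 (esym typeB) l (asboolT ext).
  split => //; have := hom_left_of b b2 h2 (etrans typeB type12) lB (asboolT extB).
  by rewrite opprD !addrA.
have next : ~~ `[< extends_left B >].
  by have [-> _] := typeB; apply/asboolPn.
have lB : left_of B (s - e) (t + e).
  have := hom_left_of_open b b2 h2 e0 _ l next.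
  rewrite typeB type12 => /(_ erefl).
  by rewrite opprD addrA subrK addrA addrK.
split => //; have := hom_left_of_open b1 b h1 e0 (esym typeB) lB.
by rewrite subrK addrK; apply => //; apply/asboolPn.
Qed.

Lemma hom_common B1 B B2 e s t : block B1 -> block B -> block B2 -> 0 <= e ->
  hom_admissible B1 B e -> hom_admissible B B2 e -> same_type B1 B2 ->
  common B1 B2 (e + e) s t ->
  [/\ B1 s t, B (s - e) (t + e) & B2 (s - (e + e)) (t + (e + e))].
Proof.
move=> b1 b b2 e0 h1 h2 [lt rt] [st l r].
have [l1 lB l2] := hom_left_common b1 b b2 e0 h1 h2 lt l.
have [r1 rB r2] := hom_left_common (block_mirror b1) (block_mirror b) (block_mirror b2)
  e0 (hom_admissible_mirror h1) (hom_admissible_mirror h2) rt r.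
split; [exact/blockE|apply/(blockE _ _ b)|apply/(blockE _ _ b2)].
  by split => //; [lra|rewrite opprD opprB [e - s]addrC].
by split => //; [lra|rewrite opprD opprB [e + e - s]addrC].
Qed.

(** Each of the two steps raises each of the two keys by at most [e]. If [B] were close to neither
    [B1] nor [B2], some key would drop by more than [e] in each step; these two drops outweigh the
    two possible rises, and the key sum would fall. *)
Lemma hom_close B1 B B2 e : block B1 -> block B -> block B2 -> 0 <= e ->
  hom_admissible B1 B e -> hom_admissible B B2 e -> same_type B1 B2 ->
  key_sum B1 <= key_sum B2 -> close_blocks B1 B e \/ close_blocks B2 B e.
Proof.
move=> b1 b b2 e0 h1 h2 [lt rt] sums.
have lB := hom_left_type b1 b b2 h1 h2 lt.
have b1' := block_mirror b1; have b' := block_mirror b; have b2' := block_mirror b2.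
have h1' := hom_admissible_mirror h1; have h2' := hom_admissible_mirror h2.
have rB := hom_left_type b1' b' b2' h1' h2' rt.
have k1 := hom_left_key b1 b h1 e0 (esym lB).
have k2 := hom_left_key b b2 h2 e0 (etrans lB lt).
have k1' := hom_left_key b1' b' h1' e0 (esym rB).
have k2' := hom_left_key b' b2' h2' e0 (etrans rB rt).
move: sums; rewrite /key_sum => sums.
have [c1|nc1] := pselect (left_key B1 - left_key B <= e /\
    left_key (mirror B1) - left_key (mirror B) <= e).
  left; split; [by split; rewrite ?lB ?rB| |].
    by rewrite ler_norml; apply/andP; split; lra.
  by rewrite ler_norml; apply/andP; split; lra.
right; split; rewrite ?ler_norml; first by split; rewrite ?lB ?rB.
  apply/andP; split; last lra.
  by rewrite leNgt; apply/negP => far; apply: nc1; split; lra.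
apply/andP; split; last lra.
rewrite leNgt; apply/negP => far; apply: nc1; split; lra.
Qed.

Lemma sup_life B : sup (life B) = - inf (life (mirror B)).
Proof.
rewrite /inf opprK; congr sup; apply/seteqP; split => x /=.
  by move=> Bx; exists (- x); rewrite ?opprK//; apply/life_mirror; rewrite opprK.
by move=> [y /life_mirror By <-].
Qed.

(* Without a common interval, B1 would lie so far to the right of B2 that its key
   sum would be the larger one. *)
Lemma common_half_open B1 B2 d c1 c2 : block B1 -> block B2 -> 0 < d ->
  centered B1 d c1 -> centered B2 d c2 -> same_type B1 B2 ->
  extends_left B1 -> ~ extends_left (mirror B1) -> key_sum B1 <= key_sum B2 ->
  exists s t, common B1 B2 d s t.
Proof.
move=> b1 b2 d0 [B1l B1u] [B2l B2u] [[ext lb] [ext' lb']] extl extr sums.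
have [[a [a' [Ba Ba' aa']]]|none] := pselect (exists a a',
    [/\ life B1 a, life B2 a' & a + d <= a']).
  (* At this single time [a] meets the left condition of [B1], and [a'] meets the right condition of
     [B2] after the shift by [d]. *)
  exists (a' - d), (a' - d); split => //.
    rewrite /left_common /left_of asboolT//; exists a => //; lra.
  rewrite /left_common /left_of asboolF// -ext' asboolF//.
  exists (- a'); first by apply/life_mirror; rewrite opprK.
  by lra.
have far a a' : life B1 a -> life B2 a' -> a' < a + d.
  by move=> Ba Ba'; rewrite ltNge; apply/negP => aa'; apply: none; exists a, a'.
have lb1 : has_lbound (life B1).
  by exists (c2 - d - d) => a Ba; have := far _ _ Ba B2l; lra.
have lb2 : has_lbound (life B2).
  by apply/asboolP; rewrite -lb; apply/asboolP.
have ub2 : has_lbound (life (mirror B2)).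
  exists (- (c1 + d + d)) => a /life_mirror Ba; have := far _ _ B1u Ba; lra.
have ub1 : has_lbound (life (mirror B1)).
  by apply/asboolP; rewrite lb'; apply/asboolP.
move: sums; rewrite /key_sum /left_key -ext -ext' !(asboolT extl) !(asboolF extr).
have := ge_inf lb1 B1l; have := ge_inf lb2 B2l.
have B1u' : life (mirror B1) (- (c1 + d)) by apply/life_mirror; rewrite opprK.
have B2u' : life (mirror B2) (- (c2 + d)) by apply/life_mirror; rewrite opprK.
have := ge_inf ub1 B1u'; have := ge_inf ub2 B2u'.
have : - (inf (life B1) + d) <= inf (life (mirror B2)).
  apply: lb_le_inf; first by exists (- (c2 + d)).
  move=> x /life_mirror Bx; have : - x - d <= inf (life B1); last by lra.
  apply: lb_le_inf; first by exists (c1 - d).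
  by move=> a Ba; have := far _ _ Ba Bx; lra.
by lra.
Qed.

Lemma common_ex B1 B2 d c1 c2 : block B1 -> block B2 -> 0 < d ->
  centered B1 d c1 -> centered B2 d c2 -> same_type B1 B2 ->
  key_sum B1 <= key_sum B2 -> exists s t, common B1 B2 d s t.
Proof.
move=> b1 b2 d0 C1 C2 type12 sums; have [[ext _] [ext' _]] := type12.
have [extl|nextl] := pselect (extends_left B1);
  have [extr|nextr] := pselect (extends_left (mirror B1)).
- have [a Ba] := life_neq0 b1; exists a, a; split => //.
    by rewrite /left_common /left_of !asboolT//; exists a.
  rewrite /left_common /left_of !asboolT//; exists (- a) => //.
  by apply/life_mirror; rewrite opprK.
- exact: common_half_open C1 C2 _ extl nextr sums.
- have [|||s [t /common_mirror st]] := common_half_open (block_mirror b1)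
    (block_mirror b2) d0 (centered_mirror C1) (centered_mirror C2) _ extr.
  + by have [? ?] := type12; split; rewrite ?mirrorK.
  + by rewrite mirrorK.
  + by move: sums; rewrite /key_sum !mirrorK !(addrC (left_key (mirror _))).
  by exists (- t), (- s).
- have [B2l B2u] := C2; exists c2, c2; split => //.
    by rewrite /left_common /left_of asboolF// -ext asboolF//; exists (c2 - d).
  rewrite /left_common /left_of asboolF// -ext' asboolF//.
  exists (- (c2 + d)); first by apply/life_mirror; rewrite opprK.
  by rewrite opprD.
Qed.

Lemma left_key_close B B' e : block B' -> left_type B = left_type B' ->
  `|left_key B - left_key B'| <= e ->
  forall a x, life B a -> a + e < x -> exists2 a', life B' a' & a' < x.
Proof.
move=> b' [ext lb]; rewrite /left_key -ext => close_keys a x Ba ax.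
have [lbB'|/has_lbPn] := pselect (has_lbound (life B')); last by move=> /(_ x).
have lbB : has_lbound (life B) by apply/asboolP; rewrite lb; apply/asboolP.
have key : inf (life B') <= inf (life B) + e.
  by move: close_keys; case: ifP => _; rewrite ler_norml => /andP[]; lra.
have iB := ge_inf lbB Ba.
have [a' Ba' a'x] : exists2 a', life B' a' & a' < inf (life B') + (x - inf (life B')).
  by apply: inf_adherent; [lra|split => //; exact: life_neq0].
by exists a' => //; lra.
Qed.

Lemma close_center B B' e d c : block B' -> close_blocks B B' e -> e < d ->
  centered B d c -> life B' c.
Proof.
move=> b' [[lt rt] lk rk] ed [Bl Bu].
have [|a' Ba' a'c] := left_key_close b' lt lk Bl (_ : _ < c); first by lra.
have Bu' : life (mirror B) (- (c + d)) by apply/life_mirror; rewrite opprK.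
have [|a'' /life_mirror Ba'' a''c] :=
  left_key_close (block_mirror b') rt rk Bu' (_ : _ < - c); first by lra.
by apply: (life_interval b' Ba' Ba''); apply/andP; split; lra.
Qed.

Lemma close_blocks_sym B B' e : close_blocks B B' e -> close_blocks B' B e.
Proof.
by move=> [[lt rt] lk rk]; split; [split|rewrite distrC|rewrite distrC].
Qed.

(** The strict inequality between [e] and [d] yields strict bounds, so the types of the thickened
    ends never matter. *)
Lemma close_thicken B B' e d : block B -> block B' -> close_blocks B B' e -> e < d ->
  life B `<=` thicken d (life B').
Proof.
move=> b b' [[lt rt] lk rk] ed a Ba.
have lower : has_lbound (life B') -> inf (life B') - d < a.
  move=> lbB'; have [|a' Ba' a'a] := left_key_close b' lt lk Ba (_ : _ < a + d).
    by rewrite ltrD2l.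
  by have := ge_inf lbB' Ba'; lra.
have upper : has_ubound (life B') -> a < sup (life B') + d.
  move=> [m mP]; have Ba' : life (mirror B) (- a) by apply/life_mirror; rewrite opprK.
  have [|a' Ba'' a'a] := left_key_close (block_mirror b') rt rk Ba' (_ : _ < - a + d).
    by rewrite ltrD2l.
  have lbB' : has_lbound (life (mirror B')).
    by exists (- m) => x /life_mirror /mP; lra.
  by have := ge_inf lbB' Ba''; rewrite sup_life; lra.
rewrite /thicken /Rhull; case: (asboolP (has_lbound (life B'))) => lb;
  case: (asboolP (has_ubound (life B'))) => ub; rewrite /= in_itv /= ?andbT//.
- by rewrite !lteifS ?lower ?upper.
- by rewrite lteifS ?lower.
- by rewrite lteifS ?upper.
Qed.

End BlockPairs.

(** * Bars of a module *)

Section CoordSum.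
Variable F : fieldType.

(** For a boolean dimension this is the only coordinate, or 0; it replaces vectors whose type
    depends on membership in the bar by scalars. *)
Definition coord_sum n (v : 'rV[F]_n) : F := \sum_i v 0 i.

Lemma coord_sum_scalar n : scalar (@coord_sum n).
Proof.
move=> a u v; rewrite /coord_sum mulr_sumr -big_split.
by apply: eq_bigr => i _; rewrite !mxE.
Qed.

Lemma coord_sum_inj (b : bool) (u v : 'rV[F]_b) : coord_sum u = coord_sum v -> u = v.
Proof.
case: b u v => u v; last by move=> _; apply/rowP => -[].
by rewrite /coord_sum !big_ord1 => uv; apply/rowP => i; rewrite ord1.
Qed.

Lemma coord_sum_const (b : bool) : coord_sum (const_mx 1 : 'rV[F]_b) = b%:R.
Proof. by case: b; rewrite /coord_sum ?big_ord1 ?big_ord0 ?mxE. Qed.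

Lemma coord_sum_out (b : bool) (v : 'rV[F]_b) : ~~ b -> coord_sum v = 0.
Proof. by case: b v => // v _; rewrite /coord_sum big_ord0. Qed.

Lemma coord_sum_pid (b b' : bool) (v : 'rV[F]_b) :
  coord_sum (v *m (pid_mx 1 : 'M[F]_(b, b'))) = if b' then coord_sum v else 0.
Proof.
case: b' => /=; last by rewrite /coord_sum big_ord0.
case: b v => v; last by rewrite /coord_sum big_ord1 big_ord0 mxE big_ord0.
by rewrite [pid_mx 1](@pid_mx_1 F 1) mulmx1.
Qed.

End CoordSum.

Section Frame.
Variables (F : fieldType) (R : realType) (M : pmod F (cint R)).
Variables (K : choiceType) (J : K -> pinterval (cint R)).

(* A decomposition of M into interval modules, as a family of compatible
   vectors with their coordinate functionals. *)
Record frame (e : K -> forall I, M I) (c : K -> forall I, M I -> F) : Prop := Frame {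
  coord_scalar : forall k I, scalar (@c k I);
  vec_out : forall k I, ~ pinterval_set (J k) I -> e k I = 0;
  coord_out : forall k I v, ~ pinterval_set (J k) I -> @c k I v = 0;
  coord_same : forall k I, pinterval_set (J k) I -> @c k I (e k I) = 1;
  coord_diff : forall k k' I, k != k' -> @c k I (e k' I) = 0;
  map_vec : forall k I I' (h : (I <= I')%O), pinterval_set (J k) I ->
    pmod_map M h (e k I) = e k I';
  coord_map : forall k I I' (h : (I <= I')%O) v, pinterval_set (J k) I' ->
    @c k I' (pmod_map M h v) = @c k I v;
  coord_expand : forall I (v : M I), exists r : seq K, [/\ uniq r,
    forall k, k \notin r -> @c k I v = 0 &
    forall phi : M I -> F, scalar phi -> phi v = \sum_(k <- r) @c k I v * phi (e k I)] }.

Lemma barcode_frame : is_barcode M J -> exists e c, frame e c.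
Proof.
move=> [f [fbij fnat]].
pose D := dsum_pmod (fun k => interval_module F (J k)).
pose b k I : bool := `[< pinterval_set (J k) I >].
pose S k I (w : D I) : F := @coord_sum F (b k I) (w k).
have Sext I (w w' : D I) : (forall k, S k I w = S k I w') -> w = w'.
  by move=> h; apply: dsum_eq => k; apply: coord_sum_inj; exact: h.
have Slin k I : scalar (S k I).
  by move=> a u v; rewrite /S dsumDE dsumZE; exact: coord_sum_scalar.
have Smap k I I' (h : (I <= I')%O) w : S k I' (pmod_map D h w) = if b k I' then S k I w else 0.
  exact: coord_sum_pid.
pose d0 k I k' : interval_module F (J k') I :=
  if k' == k then (const_mx 1 : 'rV[F]_(b k' I)) else 0.
have d0fin k I : finite_set [set k' | d0 k I k' <> 0].
  apply: (sub_finite_set _ (finite_set1 k)) => k' /=; rewrite /d0.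
  by case: eqVneq => [->//|_ /(_ erefl)].
pose d k I : D I := DSum (d0fin k I).
have Sd k k' I : S k' I (d k I) = if k' == k then (b k' I)%:R else 0.
  rewrite /S /= /d0; case: eqP => _; first exact: coord_sum_const.
  by rewrite /coord_sum big1// => i _; rewrite mxE.
have fsurj I (w : D I) : exists v, f I v = w.
  by have [g _ fK] := fbij I; exists (g w); rewrite fK.
have finj I : injective (f I) by exact: bij_inj (fbij I).
pose e k I := sval (cid (fsurj I (d k I))).
have fe k I : f I (e k I) = d k I := svalP (cid (fsurj I (d k I))).
have bP k I : reflect (pinterval_set (J k) I) (b k I) by exact: asboolP.
have lc k I : scalar (fun v => S k I (f I v)).
  by move=> a u v; rewrite linearP Slin.
exists e, (fun k I v => S k I (f I v)); split.
- exact: lc.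
- move=> k I nJ; apply: finj; rewrite fe linear0; apply: Sext => k'.
  rewrite Sd scalar0 //; case: eqP => // ->.
  by case: bP.
- by move=> k I v /bP nb; exact: coord_sum_out.
- by move=> k I /bP bkI; rewrite fe Sd eqxx bkI.
- by move=> k k' I /negPf kk'; rewrite fe Sd kk'.
- move=> k I I' h /bP bkI; apply: finj; rewrite fnat !fe; apply: Sext => k'.
  rewrite Smap !Sd; case: eqP => [->|_]; last by case: ifP.
  by rewrite bkI; case: (b k I').
- by move=> k I I' h v /bP bkI'; rewrite fnat Smap bkI'.
- move=> I v; pose r : seq K := fset_set [set k | f I v k <> 0].
  have rP k : k \notin r -> f I v k = 0.
    move=> nr; apply: contrapT => h; move/negP: nr; apply.
    by rewrite in_fset_set ?inE//; exact: dsumP.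
  have ur : uniq r by exact: fset_uniq.
  have Sr k : k \notin r -> S k I (f I v) = 0.
    by move=> /rP h; rewrite /S h /coord_sum big1// => i _; rewrite mxE.
  exists r; split => // phi lphi; rewrite -scalar_sum//; congr phi; apply: finj.
  rewrite linear_sum /=; apply: Sext => k.
  have -> : S k I (\sum_(i <- r) f I (S i I (f I v) *: e i I)) =
      \sum_(i <- r) S i I (f I v) * S k I (d i I).
    rewrite -scalar_sum//; congr (S k I); apply: eq_bigr => i _.
    by rewrite linearZ /= fe.
  have [kr|/[dup] kr /Sr ->] := boolP (k \in r).
    rewrite (bigD1_seq k) //= Sd eqxx big1 ?addr0 => [|i /negPf ik].
      case: (bP k I) => [_|nJ]; first by rewrite mulr1.
      by rewrite mulr0; move/bP: nJ => nb; exact: coord_sum_out.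
    by rewrite Sd eq_sym ik mulr0.
  rewrite big_seq big1// => i ir; rewrite Sd; case: eqP => [ki|_]; last by rewrite mulr0.
  by rewrite ki ir in kr.
Qed.

End Frame.

Arguments coord_scalar {F R M K J e c} _ k I.
Arguments vec_out {F R M K J e c} _ [k I].

Lemma row_kernel (F : fieldType) (m n : nat) (A : 'M[F]_(m, n)) : (n < m)%N ->
  exists2 v : 'rV_m, v != 0 & v *m A = 0.
Proof.
move=> nm; have /rowV0Pn[v vA v0] : kermx A != 0.
  by rewrite -mxrank_eq0 mxrank_ker subn_eq0 -ltnNge (leq_ltn_trans (rank_leq_col A)).
by exists v => //; exact/sub_kermxP.
Qed.

Section Bars.
Variables (F : fieldType) (R : realType) (M : pmod F (cint R)).
Variables (K : choiceType) (J : K -> pinterval (cint R)).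
Variables (e : K -> forall I, M I) (c : K -> forall I, M I -> F).
Hypothesis fr : frame J e c.
Implicit Types (I A B U V : cint R) (k : K).

Definition bar k (s t : R) : Prop := exists st : s <= t, pinterval_set (J k) (CInt st).

Lemma barE k I : pinterval_set (J k) I <-> bar k (lo I) (hi I).
Proof.
case: I => s t st /=; split => [|[st']]; first by exists st.
by rewrite (Prop_irrelevance st st').
Qed.

Lemma bar_life k t : life (bar k) t <-> pinterval_set (J k) (cint_pt t).
Proof. by rewrite barE. Qed.

(** With more bars at I than spanning vectors, some nontrivial combination of their coordinates
    vanishes on the spanning vectors, hence everywhere; but on the vector of a bar it returns the
    coefficient of that bar. *)
Lemma bar_pointwise_finite : pointwise_finite M ->
  forall I, finite_set [set k | pinterval_set (J k) I].
Proof.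
move=> finM I; have [n [d dP]] := finM I; apply: contrapT => infJ.
have [S SJ nS] := infinite_set_fset n.+1 infJ.
have [k0 _] : exists k0, k0 \in S by apply/fset0Pn; rewrite -cardfs_gt0; lia.
pose kth (i : 'I_#|`S|) := nth k0 S i.
have kthJ i : pinterval_set (J (kth i)) I by apply: SJ; exact: mem_nth.
have [v v0 vA] := row_kernel (\matrix_(i < #|`S|, j < n) c (kth i) (d j)) nS.
have /rV0Pn[i0 vi0] := v0.
pose phi (x : M I) : F := \sum_i v 0 i * c (kth i) x.
have lphi : scalar phi.
  move=> a x y; rewrite /phi mulr_sumr -big_split; apply: eq_bigr => i _ /=.
  by rewrite (coord_scalar fr) mulrDr mulrCA.
have phi0 : phi (e (kth i0) I) = 0.
  apply: (dP _ lphi) => j; have /rowP/(_ j) := vA; rewrite !mxE => vAj; rewrite -[RHS]vAj.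
  by apply: eq_bigr => i _; rewrite mxE.
move/eqP: vi0; apply; rewrite -phi0 /phi (bigD1 i0)//= (coord_same fr)// mulr1.
rewrite big1 ?addr0// => i ii0; rewrite (coord_diff fr) ?mulr0// /kth.
by rewrite nth_uniq// fset_uniq.
Qed.

Section Rules.
Variables (k : K) (A B U V : cint R).
Hypotheses (AU : (A <= U)%O) (BU : (B <= U)%O) (VA : (V <= A)%O) (VB : (V <= B)%O).
Hypotheses (AUlo : lo A = lo U) (BUhi : hi B = hi U) (VBlo : lo V = lo B) (VAhi : hi V = hi A).
Local Notation Jk := (pinterval_set (J k)).

(** The coordinate of the bar at A and that at B agree on V, so they glue to a functional at U. If U
    were not in the bar, its vector would become 0 there, although a coordinate takes the value 1 on
    it. *)
Lemma bar_union : cover_exact M -> Jk A \/ Jk B -> (Jk V -> Jk A /\ Jk B) -> Jk U.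
Proof.
move=> exM JAB JV; apply: contrapT => nU.
have [|gam [lgam gA gB]] := exM _ _ _ _ AU BU VA VB AUlo BUhi VBlo VAhi
    _ _ (coord_scalar fr k A) (coord_scalar fr k B).
  move=> v; have [JkV|nV] := pselect (Jk V).
    by have [JA JB] := JV JkV; rewrite !(coord_map fr).
  have side W (VW : (V <= W)%O) : c k (pmod_map M VW v) = 0.
    have [JW|nW] := pselect (Jk W); last by rewrite (coord_out fr).
    by rewrite (coord_map fr)// (coord_out fr).
  by rewrite !side.
case: JAB => [JA|JB].
  have := gA (e k A); rewrite (map_vec fr)// (vec_out fr nU) scalar0//.
  by rewrite (coord_same fr)// => /eqP; rewrite eq_sym oner_eq0.
have := gB (e k B); rewrite (map_vec fr)// (vec_out fr nU) scalar0//.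
by rewrite (coord_same fr)// => /eqP; rewrite eq_sym oner_eq0.
Qed.

(** If V were not in the bar, the coordinate at A would glue with the zero functional at B, and the
    vector at U would have both values 1 and 0. *)
Lemma bar_inter : cover_exact M -> Jk A -> Jk B -> Jk V.
Proof.
move=> exM JA JB; apply: contrapT => nV.
have z0 : scalar (fun _ : M B => 0 : F) by move=> a u v; rewrite mulr0 addr0.
have [|gam [lgam gA gB]] := exM _ _ _ _ AU BU VA VB AUlo BUhi VBlo VAhi
    _ _ (coord_scalar fr k A) z0.
  by move=> v; rewrite (coord_map fr)// (coord_out fr).
have := gB (e k B); rewrite (map_vec fr)// -(map_vec fr AU JA) gA (coord_same fr)//.
by move=> /eqP; rewrite oner_eq0.
Qed.

Lemma bar_split : cover_surjective M -> Jk U -> Jk A \/ Jk B.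
Proof.
move=> surjM JU; apply: contrapT => /not_orP[nA nB].
have BA : lo B <= hi A by rewrite -VBlo -VAhi lo_le_hi.
have : c k (e k U) = 0; last first.
  by rewrite (coord_same fr)// => /eqP; rewrite oner_eq0.
apply: surjM AU BU AUlo BUhi BA _ (coord_scalar fr k U) _ _ _ => v.
  by rewrite (coord_map fr)// (coord_out fr).
by rewrite (coord_map fr)// (coord_out fr).
Qed.

End Rules.

Section BarRules.
Variables (k : K) (s s' t t' : R).
Hypotheses (ss' : s <= s') (s't : s' <= t) (tt' : t <= t').

Let st := le_trans ss' s't.
Let s't' := le_trans s't tt'.
Let st' := le_trans st tt'.
Let A := CInt st.
Let B := CInt s't'.
Let U := CInt st'.
Let V := CInt s't.
Let AU : (A <= U)%O. Proof. by rewrite cint_leE /= lexx. Qed.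
Let BU : (B <= U)%O. Proof. by rewrite cint_leE /= lexx andbT. Qed.
Let VA : (V <= A)%O. Proof. by rewrite cint_leE /= lexx andbT. Qed.
Let VB : (V <= B)%O. Proof. by rewrite cint_leE /= lexx. Qed.

Lemma bar_union_st : cover_exact M -> bar k s t \/ bar k s' t' ->
  (bar k s' t -> bar k s t /\ bar k s' t') -> bar k s t'.
Proof.
move=> exM; rewrite -(barE k A) -(barE k B) -(barE k V) -(barE k U).
exact: bar_union AU BU VA VB _ _ _ _ exM.
Qed.

Lemma bar_inter_st : cover_exact M -> bar k s t -> bar k s' t' -> bar k s' t.
Proof.
move=> exM; rewrite -(barE k A) -(barE k B) -(barE k V).
exact: bar_inter AU BU VA VB _ _ _ _ exM.
Qed.

Lemma bar_split_st : cover_surjective M -> bar k s t' -> bar k s t \/ bar k s' t'.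
Proof.
move=> surjM; rewrite -(barE k A) -(barE k B) -(barE k U).
exact: (@bar_split k A B U V AU BU) surjM.
Qed.

End BarRules.

Lemma bar_convex k s t s' t' a b : bar k s t -> bar k s' t' ->
  s' <= a <= s -> t <= b <= t' -> bar k a b.
Proof.
move=> [st B1] [st' B2] /andP[h1 h2] /andP[h3 h4].
have ab : a <= b by lra.
exists ab; apply: pinterval_convex B1 B2 _.
by rewrite !cint_leE /= h1 h2 h3 h4.
Qed.

Section Exact.
Hypothesis exM : cover_exact M.

Lemma bar_overlap k I A B : (I <= A)%O -> (I <= B)%O ->
  pinterval_set (J k) A -> pinterval_set (J k) B ->
  exists U, [/\ pinterval_set (J k) U, (A <= U)%O & (B <= U)%O].
Proof.
wlog AB : A B / lo A <= lo B.
  move=> H IA IB JA JB; have [AB|/ltW BA] := leP (lo A) (lo B); first exact: H.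
  by have [U [JU BU AU]] := H _ _ BA IB IA JB JA; exists U.
rewrite !cint_leE => /andP[IA1 IA2] /andP[IB1 IB2] JA JB; have Ile := lo_le_hi I.
have [BA|/ltW BA] := leP (hi B) (hi A).
  by exists A; split => //; rewrite cint_leE AB.
have /barE := JA; have /barE := JB => bB bA.
have [|st JU] := bar_union_st AB _ BA exM (or_introl bA) (fun _ => conj bA bB).
  by lra.
by exists (CInt st); split => //; rewrite cint_leE /= ?lexx ?AB ?BA.
Qed.

(** Induction along a path of comparable intervals: a step upwards keeps the upper bound found so
    far, a step downwards produces two overlapping intervals, whose union is again in the bar. *)
Lemma bar_directed k A B : pinterval_set (J k) A -> pinterval_set (J k) B ->
  exists U, [/\ pinterval_set (J k) U, (A <= U)%O & (B <= U)%O].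
Proof.
move=> JA JB; have [r [rpath <- rJ]] := pinterval_connected JA JB.
elim: r A JA rpath rJ {B JB} => [|B r IHr] A JA /=.
  by exists A; split.
move=> /andP[AB rpath] rJ.
have JB : pinterval_set (J k) B by apply: rJ; rewrite inE eqxx.
have [|U [JU BU lU]] := IHr B JB rpath.
  by move=> C Cr; apply: rJ; rewrite inE Cr orbT.
have [AleB|BleA] := orP AB.
  by exists U; split => //; exact: le_trans BU.
have [W [JW AW UW]] := bar_overlap BleA BU JA JU.
by exists W; split => //; exact: le_trans UW.
Qed.

Lemma bar_hull k s t s' t' : bar k s t -> bar k s' t' ->
  bar k (Num.min s s') (Num.max t t').
Proof.
move=> B1 B2; have [st J1] := B1; have [st' J2] := B2.
have [U [/barE JU]] := bar_directed J1 J2.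
rewrite !cint_leE /= => /andP[h1 h2] /andP[h3 h4].
apply: (bar_convex B1 JU); rewrite ?ge_min ?le_min ?le_max ?ge_max ?lexx ?h1 ?h2 ?h3 ?h4 //.
Qed.

Hypothesis surjM : cover_surjective M.
Hypothesis locM : locally_generated M.

(** The point is the infimum m of the right ends x with [s, x] in the bar. By local generation a
    short interval of the bar around m suffices; it is obtained by splitting some [s, x] shortly
    before m. *)
Lemma bar_point k s t : bar k s t -> exists2 p, s <= p <= t & bar k p p.
Proof.
move=> Bst; have [st _] := Bst.
pose E : set R := [set x | s <= x <= t /\ bar k s x].
have Et : E t by split; rewrite ?lexx ?st.
have lbE : has_lbound E by exists s => x [/andP[]].
pose m := inf E.
have mt : m <= t by exact: ge_inf.
have sm : s <= m by apply: lb_le_inf; [exists t|move=> x [/andP[]]].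
have [r r0 rP] := locM m.
have near a b : a <= m <= b -> m - r < a -> b < m + r -> bar k a b -> bar k m m.
  move=> /andP[am mb] ra br /[dup] Bab [ab Jab].
  apply/(bar_life k m).2; apply: contrapT => nJ.
  have pI : (cint_pt m <= CInt ab)%O by rewrite cint_leE /= am.
  have : c k (e k (CInt ab)) = 0; last first.
    by rewrite (coord_same fr)// => /eqP; rewrite oner_eq0.
  apply: (rP _ pI ra br _ (coord_scalar fr k _)) => v.
  by rewrite (coord_map fr)// (coord_out fr).
exists m; first by rewrite sm.
have [x [/andP[sx xt] Bsx] xm] : exists2 x, E x & x < m + r.
  by apply: inf_adherent => //; split => //; exists t.
have mx : m <= x by apply: ge_inf => //; split; rewrite ?sx.
have [sy|ys] := leP s (m - r / 2); last first.
  by apply: near Bsx; rewrite ?sm//; lra.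
have yx : m - r / 2 <= x by lra.
(* The left part would have a right end below the infimum [m], so the right part, which is short,
   lies in the bar. *)
have [Bsy|Byx] := bar_split_st sy (lexx _) yx surjM Bsx.
  have : m <= m - r / 2 by apply: ge_inf => //; split => //; apply/andP; split; lra.
  by move=> ?; exfalso; lra.
by apply: near Byx => //; [apply/andP; split; lra|lra].
Qed.

Lemma bar_block k : block (bar k).
Proof.
split.
- by move=> s t [].
- have [I /barE JI] := pinterval_neq0 (J k); by exists (lo I), (hi I).
- by move=> s t s' t' a b; exact: bar_convex.
- by move=> s t s' t'; exact: bar_hull.
- by move=> s t s' t' B1 B2 h1 h2 h3; exact: (bar_inter_st h1 h2 h3 exM).
- move=> s t s' t' B1 nB h1 h2 h3; apply: contrapT => nV; apply: nB.
  by apply: (bar_union_st h1 h2 h3 exM); [left|].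
- move=> s t s' t' B1 nB h1 h2 h3; apply: contrapT => nV; apply: nB.
  by apply: (bar_union_st h1 h2 h3 exM); [right|].
- by move=> s t; exact: bar_point.
Qed.

End Exact.

End Bars.

(** * Interleaved modules *)

Section CIntHull.
Variable R : realType.
Implicit Types I J : cint R.

Fact cint_hull_subproof I J : Num.min (lo I) (lo J) <= Num.max (hi I) (hi J).
Proof. by rewrite ge_min le_max lo_le_hi. Qed.

Definition cint_hull I J : cint R := CInt (cint_hull_subproof I J).

Lemma cint_hull_lel I J : (I <= cint_hull I J)%O.
Proof. by rewrite cint_leE /= ge_min le_max !lexx. Qed.

Lemma cint_hull_ler I J : (J <= cint_hull I J)%O.
Proof. by rewrite cint_leE /= ge_min le_max !lexx !orbT. Qed.

End CIntHull.

Section Coefficients.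
Variables (F : fieldType) (R : realType) (M N : pmod F (cint R)).
Variables (K L : choiceType) (J : K -> pinterval (cint R)) (J' : L -> pinterval (cint R)).
Variables (u : K -> forall I, M I) (c : K -> forall I, M I -> F).
Variables (u' : L -> forall I, N I) (c' : L -> forall I, N I -> F).
Hypotheses (frM : frame J u c) (frN : frame J' u' c').
Hypotheses (exM : cover_exact M) (exN : cover_exact N).
Variables (e : R) (e0 : 0 <= e) (f : forall I, {linear M I -> N (cint_thicken e0 I)}).
Hypothesis fnat : forall I I' (h : (I <= I')%O) v,
  f I' (pmod_map M h v) = pmod_map N (cint_thicken_le e0 h) (f I v).

Let entry k l I : F := c' l (f I (u k I)).

Let both k l I : Prop :=
  pinterval_set (J k) I /\ pinterval_set (J' l) (cint_thicken e0 I).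

Lemma entry_support k l I : entry k l I != 0 -> both k l I.
Proof.
move=> h; split; apply: contrapT => nJ; move/eqP: h; apply; rewrite /entry.
  by rewrite (vec_out frM)// linear0 (scalar0 (coord_scalar frN _ _)).
by rewrite (coord_out frN).
Qed.

Lemma entry_le k l I I' : (I <= I')%O -> pinterval_set (J k) I ->
  pinterval_set (J' l) (cint_thicken e0 I') -> entry k l I = entry k l I'.
Proof.
move=> II' JI J'I'; rewrite /entry -(map_vec frM II')// fnat.
by rewrite (coord_map frN).
Qed.

Lemma entry_const k l I I' : both k l I -> both k l I' -> entry k l I = entry k l I'.
Proof.
move=> [JI J'I] [JI' J'I']; pose H := cint_hull I I'.
(* Thickening commutes with hulls. The hull itself need not lie in the source bar. *)
have J'H : pinterval_set (J' l) (cint_thicken e0 H).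
  apply/(barE J'); have := bar_hull frN exN ((barE J' l _).1 J'I) ((barE J' l _).1 J'I').
  by rewrite /= addr_minl addr_maxl.
rewrite (entry_le (cint_hull_lel I I'))// -(entry_le (cint_hull_ler I I'))//.
Qed.

(* Interval modules being connected, a homomorphism between two of them is a
   scalar, which vanishes unless the blocks are in suitable position. *)
Lemma hom_coefficient : exists a : K -> L -> F,
  (forall k l I, pinterval_set (J k) I -> pinterval_set (J' l) (cint_thicken e0 I) ->
    c' l (f I (u k I)) = a k l) /\
  (forall k l, a k l != 0 -> hom_admissible (bar J k) (bar J' l) e).
Proof.
have /choice[a aP] (kl : K * L) : exists a : F,
    (forall I, both kl.1 kl.2 I -> entry kl.1 kl.2 I = a) /\
    (a != 0 -> exists2 I, both kl.1 kl.2 I & entry kl.1 kl.2 I = a).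
  case: kl => k l /=; have [[I bI]|nb] := pselect (exists I, both k l I).
    exists (entry k l I); split => [I' bI'|_]; first exact: entry_const.
    by exists I.
  by exists 0; split => [I bI|/eqP//]; case: nb; exists I.
exists (fun k l => a (k, l)); split => [k l I JI J'I|k l akl].
  by have [+ _] := aP (k, l); apply.
have [aE /(_ akl)[I0 bI0 _]] := aP (k, l).
have bothE s t (st : s <= t) : bar J k s t -> bar J' l (s - e) (t + e) -> both k l (CInt st).
  by move=> B1 B2; split; [apply/(barE J)|apply/(barE J')].
have [JI0 J'I0] := bI0.
split.
- by exists (lo I0), (hi I0); split; [exact/(barE J)|exact/(barE J' _ (cint_thicken e0 I0))].
- move=> s t s' t' B1 B2 ss' tt' B2'; have [st _] := B1.
  have st' : s' <= t' by lra.
  have bI := bothE _ _ st B1 B2.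
  have le : (CInt st <= CInt st')%O by rewrite cint_leE /= ss' tt'.
  have J'I' : pinterval_set (J' l) (cint_thicken e0 (CInt st')) by apply/(barE J').
  have [JI _] := bI.
  have : entry k l (CInt st') != 0 by rewrite -(entry_le le JI J'I') (aE _ bI).
  by move=> /entry_support[/(barE J)].
- move=> s t s' t' B1 B2 ss' tt' B1'; have [st _] := B1; have [st' _] := B1'.
  have bI := bothE _ _ st B1 B2.
  have le : (CInt st' <= CInt st)%O by rewrite cint_leE /= ss' tt'.
  have JI' : pinterval_set (J k) (CInt st') by apply/(barE J).
  have [_ J'I] := bI.
  have : entry k l (CInt st') != 0 by rewrite (entry_le le JI' J'I) (aE _ bI).
  by move=> /entry_support[_ /(barE J' _ (cint_thicken e0 _))].
Qed.

End Coefficients.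

Lemma big_uniq_support (V : nmodType) (T : choiceType) (r r' : seq T) (h h' : T -> V) :
  uniq r -> uniq r' -> (forall t, t \notin r -> h t = 0) ->
  (forall t, t \notin r' -> h' t = 0) -> (forall t, h t = h' t) ->
  \sum_(t <- r) h t = \sum_(t <- r') h' t.
Proof.
move=> ur ur' hr hr' hh'.
rewrite (bigfs _ ur) => [|t _ /hr//]; rewrite (bigfs _ ur') => [|t _ /hr'//].
exact: eq_fsbigr.
Qed.

Section Interleaved.
Variables (F : fieldType) (R : realType) (M N : pmod F (cint R)).
Variables (K L : choiceType) (J : K -> pinterval (cint R)) (J' : L -> pinterval (cint R)).
Hypotheses (barcM : is_barcode M J) (barcN : is_barcode N J').
Hypotheses (exM : cover_exact M) (exN : cover_exact N).
Hypotheses (surjM : cover_surjective M) (surjN : cover_surjective N).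
Hypotheses (locM : locally_generated M) (locN : locally_generated N).
Hypothesis (finN : pointwise_finite N).
Variables (e : R) (e0 : 0 <= e).
Variables (f : forall I, {linear M I -> N (cint_thicken e0 I)}).
Variables (g : forall I, {linear N I -> M (cint_thicken e0 I)}).
Hypothesis fg : interleaving f g.
Hypothesis epos : 0 < e.

Let bM k : block (bar J k).
Proof. by have [u [c fr]] := barcode_frame barcM; exact: bar_block fr _ _ _ _. Qed.

Let bN l : block (bar J' l).
Proof. by have [u [c fr]] := barcode_frame barcN; exact: bar_block fr _ _ _ _. Qed.

(** [T] may be any finite list containing the bars close to k or to k': a nonzero product of
    coefficients forces closeness to one of the two, so further bars contribute nothing. *)
Lemma interleaving_coefficients : exists (a : K -> L -> F) (b : L -> K -> F),
  [/\ forall k l, a k l != 0 -> hom_admissible (bar J k) (bar J' l) e,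
      forall l k, b l k != 0 -> hom_admissible (bar J' l) (bar J k) e &
      forall (k k' : K) d d' (T : seq L), uniq T ->
        centered (bar J k) (e + e) d -> centered (bar J k') (e + e) d' ->
        same_type (bar J k) (bar J k') -> key_sum (bar J k) <= key_sum (bar J k') ->
        (forall l, close_blocks (bar J k) (bar J' l) e \/ close_blocks (bar J k') (bar J' l) e ->
          l \in T) ->
        \sum_(l <- T) a k l * b l k' = (k == k')%:R].
Proof.
have [u [c frM]] := barcode_frame barcM; have [u' [c' frN]] := barcode_frame barcN.
have [fnat gnat gf _] := fg.
have [a [aE ahom]] := hom_coefficient frM frN exN fnat.
have [b [bE bhom]] := hom_coefficient frN frM exM gnat.
exists a, b; split => // k k' d d' T uT Ck Ck' type_kk' sums closeT.
have ee : 0 < e + e by exact: addr_gt0.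
have [s [t st]] := common_ex (bM k) (bM k') ee Ck Ck' type_kk' sums.
have [st' _ _] := st; pose I := CInt st'.
pose I1 := cint_thicken e0 I; pose I2 := cint_thicken e0 I1.
have I2E B : B (lo I2) (hi I2) = B (s - (e + e)) (t + (e + e)) :> Prop.
  by rewrite /= opprD !addrA.
pose w : N I1 := f I (u k I).
have lphi : scalar (fun v : N I1 => c k' I2 (g I1 v)).
  exact: scalar_comp (coord_scalar frM k' I2).
have [r [ur rout rE]] := coord_expand frN w.
have key : \sum_(l <- r) c' l I1 w * c k' I2 (g I1 (u' l I1)) = (k == k')%:R.
  rewrite -(rE _ lphi) /w gf; have [kk'|kk'] := eqVneq k k'.
    subst k'.
    (* On the diagonal the interval and its thickening by [2e] lie in the same bar, so the structure
       map preserves its coordinate. *)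
    have [B1 B2] := common_self (bM k) (ltW ee) st.
    have JI2 : pinterval_set (J k) I2 by apply/(barE J); rewrite I2E.
    by rewrite (coord_map frM)// (coord_same frM)//; exact/(barE J k I).
  have [JI|nJ] := pselect (pinterval_set (J k) I).
    by rewrite (map_vec frM)// (coord_diff frM)// eq_sym.
  by rewrite (vec_out frM nJ) linear0 (scalar0 (coord_scalar frM _ _)).
rewrite -key; apply: big_uniq_support => //.
- move=> l lT; apply: contrapT => /eqP; rewrite mulf_eq0 negb_or => /andP[al bl].
  move/negP: lT; apply; apply: closeT.
  exact: hom_close (bM k) (bN l) (bM k') e0 (ahom _ _ al) (bhom _ _ bl) type_kk' sums.
- by move=> l /rout ->; rewrite mul0r.
- move=> l; have [|] := boolP ((a k l != 0) && (b l k' != 0)).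
    move=> /andP[al bl].
    have [B1 B B2] := hom_common (bM k) (bN l) (bM k') e0 (ahom _ _ al) (bhom _ _ bl)
      type_kk' st.
    have JI : pinterval_set (J k) I by exact/(barE J k I).
    have J'I1 : pinterval_set (J' l) I1 by exact/(barE J' l I1).
    have JI2 : pinterval_set (J k') I2 by apply/(barE J); rewrite I2E.
    by rewrite -(aE _ _ I JI J'I1) -(bE _ _ I1 J'I1 JI2).
  move=> ab0; have -> : a k l * b l k' = 0.
    by apply/eqP; rewrite mulf_eq0; move: ab0; rewrite negb_and !negbK.
  apply/esym/eqP; apply: contraR ab0; rewrite mulf_eq0 negb_or => /andP[cw cg].
  have [JI J'I1] := entry_support frM frN cw.
  have [_ JI2] := entry_support frN frM cg.
  by rewrite -(aE _ _ I JI J'I1) -(bE _ _ I1 J'I1 JI2) cw.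
Qed.

(* Otherwise the rows of coefficients of the bars of S are linearly dependent.
   Composing a linear relation with the homomorphisms back to the bar of largest
   key sum that occurs in it shows that this bar does not occur. *)
Lemma hall_inequality (S : {fset K}) (nb : K -> {fset L}) :
  (forall k, k \in S -> exists d, centered (bar J k) (e + e) d) ->
  (forall k l, k \in S -> close_blocks (bar J k) (bar J' l) e -> l \in nb k) ->
  (#|` S| <= #|` neighbours nb S|)%N.
Proof.
move=> CS closeS; rewrite leqNgt; apply/negP => TS.
have [a [b [ahom bhom abE]]] := interleaving_coefficients.
set T := neighbours nb S in TS.
pose kk := tnth (in_tuple (enum_fset S)); pose ll := tnth (in_tuple (enum_fset T)).
have kkS i : kk i \in S by exact: mem_tnth.
pose st k l := `[< same_type (bar J k) (bar J' l) >].
(* Masking by type decouples the rows of different types; key sums are comparable within one type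
   only. *)
pose A : 'M[F]_(_, _) := \matrix_(i, j) if st (kk i) (ll j) then a (kk i) (ll j) else 0.
have [v v0 vA] := row_kernel A TS.
have /rV0Pn[i0 vi0] := v0.
pose P i := (v 0 i != 0) && `[< same_type (bar J (kk i)) (bar J (kk i0)) >].
have Pi0 : P i0 by rewrite /P vi0; apply/asboolP.
have [i1 /andP[vi1 /asboolP type_i1] i1max] := arg_maxP (fun i => key_sum (bar J (kk i))) Pi0.
have /eqP := vi1; apply.
pose w l := if st (kk i1) l then b l (kk i1) else 0.
have -> : 0 = \sum_j (v *m A) 0 j * w (ll j).
  by rewrite vA big1// => j _; rewrite mxE mul0r.
under eq_bigr do rewrite mxE mulr_suml.
rewrite exchange_big /=.
have row i : v 0 i != 0 -> \sum_j v 0 i * A i j * w (ll j) = v 0 i * (i == i1)%:R.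
  move=> vi; under eq_bigr do rewrite -mulrA mxE; rewrite -mulr_sumr; congr (_ * _).
  rewrite -(big_tnth _ _ _ xpredT (fun l => (if st (kk i) l then a (kk i) l else 0) * w l)).
  have [type_ii1|ntype] := pselect (same_type (bar J (kk i)) (bar J (kk i1))).
    have -> : (i == i1)%:R = (kk i == kk i1)%:R :> F.
      by rewrite (inj_eq (tuple_uniqP (in_tuple (enum_fset S)) (fset_uniq S))).
    have [d dP] := CS _ (kkS i); have [d1 d1P] := CS _ (kkS i1).
    rewrite -(abE _ _ _ _ T (fset_uniq T) dP d1P type_ii1).
    - apply: eq_bigr => l _; rewrite /w.
      (* The mask changes no product: a nonzero one has an intermediate bar of the same type as its
         two ends. *)
      have [/eqP ab0|] := boolP (a (kk i) l * b l (kk i1) == 0).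
        by rewrite ab0; case: ifP; case: ifP; rewrite ?mul0r ?mulr0.
      rewrite mulf_eq0 negb_or => /andP[/ahom h1 /bhom h2].
      have [lt rt] := type_ii1.
      have lt' := hom_left_type (bM _) (bN l) (bM _) h1 h2 lt.
      have rt' := hom_left_type (block_mirror (bM _)) (block_mirror (bN l))
        (block_mirror (bM _)) (hom_admissible_mirror h1) (hom_admissible_mirror h2) rt.
      by rewrite /st !asboolT//; split; rewrite ?lt' ?rt'.
    - apply: i1max; rewrite /P vi; apply/asboolP.
      by have [? ?] := type_ii1; have [? ?] := type_i1; split; congruence.
    - move=> l [cl|cl]; apply/neighboursP; first by exists (kk i) => //; exact: closeS cl.
      by exists (kk i1) => //; exact: closeS cl.
  have /negPf -> : i != i1 by apply/eqP => ii1; apply: ntype; rewrite ii1.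
  rewrite big1// => l _; rewrite /w /st.
  case: asboolP => [[? ?]|_]; last by rewrite mul0r.
  case: asboolP => [[? ?]|_]; last by rewrite mulr0.
  by exfalso; apply: ntype; split; congruence.
rewrite (bigD1 i1)//= row// eqxx mulr1 big1 ?addr0// => i ii1.
have [vi|vi] := eqVneq (v 0 i) 0; last by rewrite row// (negPf ii1) mulr0.
by rewrite vi big1// => j _; rewrite !mul0r.
Qed.

Lemma half_matching : exists sigma : K -> option L,
  [/\ partial_injective sigma,
      forall k, (exists d, centered (bar J k) (e + e) d) -> exists l, sigma k = Some l &
      forall k l, sigma k = Some l -> close_blocks (bar J k) (bar J' l) e].
Proof.
have [u [c frN]] := barcode_frame barcN.
pose A := [set k | exists d, centered (bar J k) (e + e) d].
pose nb k : {fset L} := fset_set [set l | close_blocks (bar J k) (bar J' l) e].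
have nbP k l : A k -> l \in nb k <-> close_blocks (bar J k) (bar J' l) e.
  move=> [d dP]; rewrite in_fset_set ?inE ?in_setE//.
  apply: (sub_finite_set _ (bar_pointwise_finite frN finN (cint_pt d))) => l' /= cl.
  apply/(bar_life J' l' d); apply: close_center (bN l') cl _ dP.
  by rewrite ltrDl.
have [S SA|sigma [s1 s2 s3]] := @hall_infinite K L A nb.
  by apply: hall_inequality => [k /SA//|k l /SA Ak /(nbP _ _ Ak)].
exists sigma; split => //.
by move=> k l /s2[Ak /(nbP _ _ Ak)].
Qed.

End Interleaved.

(** * From interleavings to the inequality of distances *)

Lemma sval_inj (T : Type) (P : T -> Prop) (x y : {t | P t}) : sval x = sval y -> x = y.
Proof.
case: x y => x Px [y Py] /= xy; case: _ / xy in Py *.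
by congr exist; exact: Prop_irrelevance.
Qed.

Lemma long_centered (R : realType) (K : choiceType) (J : K -> pinterval (cint R))
    (k : {k | exists t, pinterval_set (J k) (cint_pt t)}) (e : R) :
  0 <= e -> long (2 * (2 * e)) (barcZZ J k) ->
  exists d, centered (bar J (sval k)) (e + e) d.
Proof.
move=> e0 [t tP]; exists (t + (e + e)); split; apply/bar_life/tP.
  by rewrite /= in_itv /= addrK lexx/=; lra.
by rewrite /= in_itv /=; apply/andP; split; lra.
Qed.

Section Matching.
Variables (F : fieldType) (R : realType) (M N : pmod F (cint R)).
Variables (K L : choiceType) (J : K -> pinterval (cint R)) (J' : L -> pinterval (cint R)).

Lemma interleaving_matching (e : R) (e0 : 0 <= e)
  (f : forall I, {linear M I -> N (cint_thicken e0 I)})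
  (g : forall I, {linear N I -> M (cint_thicken e0 I)}) :
  is_barcode M J -> is_barcode N J' -> cover_exact M -> cover_exact N ->
  cover_surjective M -> cover_surjective N ->
  locally_generated M -> locally_generated N ->
  pointwise_finite M -> pointwise_finite N -> 0 < e -> interleaving f g ->
  exists sigma, is_matching (barcZZ J) (barcZZ J') (2 * e) sigma.
Proof.
move=> barcM barcN exM exN surjM surjN locM locN finM finN epos fg.
have gf : interleaving g f by have [] := fg; split.
have [s [sinj sdom sclose]] := half_matching barcM barcN exM exN surjM surjN locM locN finN fg epos.
have [r [rinj rdom rclose]] := half_matching barcN barcM exN exM surjN surjM locN locM finM gf epos.
have [h [hinj hs hr hE]] := mendelsohn_dulmage sinj rinj.
have hclose k l : h k = Some l -> close_blocks (bar J k) (bar J' l) e.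
  by move=> /hE[/sclose//|/rclose/close_blocks_sym].
have [u [c frM]] := barcode_frame barcM; have [u' [c' frN]] := barcode_frame barcN.
have bM k : block (bar J k) by exact: bar_block frM _ _ _ _.
have bN l : block (bar J' l) by exact: bar_block frN _ _ _ _.
(* Every bar has a nonempty trace on the points, so none is lost in passing to [barcZZ]. *)
have neK k : exists t, pinterval_set (J k) (cint_pt t).
  by have [t /bar_life] := life_neq0 (bM k); exists t.
have neL l : exists t, pinterval_set (J' l) (cint_pt t).
  by have [t /bar_life] := life_neq0 (bN l); exists t.
have lifeE (T : choiceType) (JT : T -> pinterval (cint R))
    (k : {k | exists t, pinterval_set (JT k) (cint_pt t)}) :
    barcZZ JT k = life (bar JT (sval k)).
  by apply/seteqP; split => t /bar_life.
have ee : e < 2 * e by lra.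
exists (fun k => omap (fun l => exist _ l (neL l)) (h (sval k))); split.
- move=> k k' l; case hk: (h (sval k)) => [m|//]; case hk': (h (sval k')) => [m'|//] /= [<-] [mm'].
  by rewrite mm' in hk'; apply: sval_inj; exact: hinj hk hk'.
- move=> k /(long_centered e0)/sdom/hs[l hl].
  by exists (exist _ l (neL l)); rewrite hl.
- move=> l /(long_centered e0)/rdom/hr[k hk].
  by exists (exist _ k (neK k)); rewrite /= hk /=; congr Some; exact: sval_inj.
- move=> k l; case hk: (h (sval k)) => [m|//] /= [<-].
  rewrite !lifeE /=; have cl := hclose _ _ hk; split.
    exact: close_thicken (bM _) (bN _) cl ee.
  exact: close_thicken (bN _) (bM _) (close_blocks_sym cl) ee.
Qed.

End Matching.

Lemma subpart_interleaved_le (R : realType) (Z : Type) (theta theta' : R -> subpart Z)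
    (e e' : R) : e <= e' ->
  subpart_interleaved theta theta' e -> subpart_interleaved theta theta' e'.
Proof.
move=> ee' h b d /h[h1 h2].
have sub (th : R -> subpart Z) :
    (join_over th `[b - e, d + e] <= join_over th `[b - e', d + e'])%O.
  apply/subpart_join_le/image_subset => x; rewrite /= !in_itv /= => /andP[? ?].
  by apply/andP; split; lra.
by split; [exact: le_trans h1 (sub _)|exact: le_trans h2 (sub _)].
Qed.

(** Both the distance and the condition on a tripod are infima that need not be attained, so an
    honest interleaving is available only strictly above them. *)
Lemma dI_formigram_lt (R : realType) (X Y : Type) (thetaX : formigram R X)
    (thetaY : formigram R Y) (e : R) : (dI_formigram thetaX thetaY < e%:E)%E ->
  0 < e /\ exists T : tripod X Y, subpart_interleaved
    (pullback (@legl_surj _ _ T) thetaX) (pullback (@legr_surj _ _ T) thetaY) e.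
Proof.
move=> /ereal_inf_lt[_ [a [a0 [T Ta]] <-]]; rewrite lte_fin => ae.
have /ereal_inf_lt[_ [b [b0 Tb] <-]] : (dI_subpart (pullback (@legl_surj _ _ T) thetaX)
    (pullback (@legr_surj _ _ T) thetaY) < e%:E)%E.
  by apply: le_lt_trans Ta _; rewrite lte_fin.
rewrite lte_fin => be; split; first exact: le_lt_trans be.
by exists T; exact: subpart_interleaved_le (ltW be) Tb.
Qed.

Theorem corollary4p16 (R : realType) (F : fieldType) (X Y : finType)
  (hX : (0 < #|X|)%N) (hY : (0 < #|Y|)%N)
  (thetaX : formigram R X) (thetaY : formigram R Y)
  (KX : Type) (JX : KX -> pinterval (cint R))
  (hJX : is_barcode (formigram_pmod F thetaX) JX)
  (KY : Type) (JY : KY -> pinterval (cint R))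
  (hJY : is_barcode (formigram_pmod F thetaY) JY) :
  (dB (barcZZ JX) (barcZZ JY) <= 2%:E * dI_formigram thetaX thetaY)%E.
Proof.
have dI0 : (0 <= dI_formigram thetaX thetaY)%E.
  by apply/ereal_infP => _ [e [e0 _] <-]; rewrite lee_fin.
have bound (e : R) : (dI_formigram thetaX thetaY < e%:E)%E ->
    (dB (barcZZ JX) (barcZZ JY) <= (2 * e)%:E)%E.
  move=> /dI_formigram_lt[e0 [T /(tripod_interleaving F (ltW e0))[f [g fg]]]].
  apply: ge_ereal_inf; exists (2 * e)%:E => //; exists (2 * e) => //.
  split; first by rewrite mulr_ge0// ltW.
  (* The index types are arbitrary and receive their choice structure classically. *)
  exact: (@interleaving_matching F R _ _ {classic KX} {classic KY} JX JY e (ltW e0) f g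
    hJX hJY (@formigram_cover_exact _ F _ thetaX) (@formigram_cover_exact _ F _ thetaY)
    (@formigram_cover_surjective _ F _ thetaX) (@formigram_cover_surjective _ F _ thetaY)
    (@formigram_locally_generated _ F _ thetaX) (@formigram_locally_generated _ F _ thetaY)
    (@formigram_pointwise_finite _ F _ thetaX) (@formigram_pointwise_finite _ F _ thetaY) e0 fg).
case dIE : (dI_formigram thetaX thetaY) dI0 => [d| |] // d0; last first.
  by rewrite gt0_muley ?leey// lte_fin.
(* The slack r / 2 above the distance becomes r after doubling. *)
apply/lee_addgt0Pr => r r0.
have /bound : (dI_formigram thetaX thetaY < (d + r / 2)%:E)%E.
  by rewrite dIE lte_fin ltrDl divr_gt0.
by rewrite mulrDr mulrCA divff// mulr1 EFinD EFinM.
Qed.
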